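(* For $X>0$ let $R(X)$ be the number of real quadratic fields $K$ with discriminant $\Delta_K \le X$ such that there exists an elliptic curve $E/K$ with everywhere good reduction over $K$ and rational $j$-invariant $j(E)\in\mathbb{Q}$. Then $$R(X) \gg \frac{X}{\sqrt{\log X}}.$$
   Context: An elliptic curve $E/K$ over a number field $K$ has everywhere good reduction if it has good reduction at every prime of $\mathcal{O}_K$. *)

(* Defs.v *)
From HB Require Import structures.
From mathcomp Require Import all_boot all_order all_algebra all_field.
Set Implicit Arguments. Unset Strict Implicit. Unset Printing Implicit Defensive.
Import Order.TTheory GRing.Theory Num.Theory.
Local Open Scope ring_scope.

Definition squarefree (n : nat) : Prop :=
  forall p : nat, prime p -> ~~ (p * p %| n)%N.

Definition qfield (d : nat) (x : algC) : Prop :=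
  exists a b : rat, x = ratr a + ratr b * sqrtC (d%:R).

Definition qint (d : nat) (x : algC) : Prop := qfield d x /\ x \in Aint.

Definition qdisc (d : nat) : nat := if (d %% 4 == 1)%N then d else (4 * d)%N.

Definition is_prime_ideal (d : nat) (P : algC -> Prop) : Prop :=
  (forall x, P x -> qint d x) /\
  P 0 /\
  (forall x y, P x -> P y -> P (x + y)) /\
  (forall r x, qint d r -> P x -> P (r * x)) /\
  (exists x, P x /\ x != 0) /\
  ~ P 1 /\
  (forall x y, qint d x -> qint d y -> P (x * y) -> P x \/ P y).

Definition loc_int (d : nat) (P : algC -> Prop) (x : algC) : Prop :=
  exists y z, [/\ qint d y, qint d z, ~ P z & x = y / z].
Definition loc_unit (d : nat) (P : algC -> Prop) (x : algC) : Prop :=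
  loc_int d P x /\ x != 0 /\ loc_int d P x^-1.

(* Weierstrass equations y^2 + a1 xy + a3 y = x^3 + a2 x^2 + a4 x + a6. *)
Record weier := Weier { a1 : algC; a2 : algC; a3 : algC; a4 : algC; a6 : algC }.

Definition wb2 (E : weier) := a1 E ^+ 2 + 4 * a2 E.
Definition wb4 (E : weier) := 2 * a4 E + a1 E * a3 E.
Definition wb6 (E : weier) := a3 E ^+ 2 + 4 * a6 E.
Definition wb8 (E : weier) :=
  a1 E ^+ 2 * a6 E + 4 * a2 E * a6 E - a1 E * a3 E * a4 E
  + a2 E * a3 E ^+ 2 - a4 E ^+ 2.
Definition wdisc (E : weier) :=
  - wb2 E ^+ 2 * wb8 E - 8 * wb4 E ^+ 3 - 27 * wb6 E ^+ 2
  + 9 * wb2 E * wb4 E * wb6 E.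
Definition wc4 (E : weier) := wb2 E ^+ 2 - 24 * wb4 E.
Definition jinv (E : weier) := wc4 E ^+ 3 / wdisc E.

Definition ell_over (d : nat) (E : weier) : Prop :=
  [/\ qfield d (a1 E), qfield d (a2 E), qfield d (a3 E), qfield d (a4 E) &
      qfield d (a6 E)] /\ wdisc E != 0.

(* The equation obtained from E by the standard change of variables
   x = u^2 x' + r, y = u^3 y' + u^2 s x' + t  (u <> 0). *)
Definition wchange (E : weier) (u r s t : algC) : weier :=
  Weier ((a1 E + 2 * s) / u)
        ((a2 E - s * a1 E + 3 * r - s ^+ 2) / u ^+ 2)
        ((a3 E + r * a1 E + 2 * t) / u ^+ 3)
        ((a4 E - s * a3 E + 2 * r * a2 E - (t + r * s) * a1 E
          + 3 * r ^+ 2 - 2 * s * t) / u ^+ 4)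
        ((a6 E + r * a4 E + r ^+ 2 * a2 E + r ^+ 3 - t * a3 E - t ^+ 2
          - r * t * a1 E) / u ^+ 6).

Definition good_red_at (d : nat) (E : weier) (P : algC -> Prop) : Prop :=
  exists u r s t : algC,
    [/\ qfield d u, u != 0, qfield d r, qfield d s & qfield d t] /\
    let E' := wchange E u r s t in
    [/\ loc_int d P (a1 E'), loc_int d P (a2 E'), loc_int d P (a3 E'),
        loc_int d P (a4 E') & loc_int d P (a6 E')] /\
    loc_unit d P (wdisc E').

Definition everywhere_good (d : nat) (E : weier) : Prop :=
  forall P, is_prime_ideal d P -> good_red_at d E P.

Definition has_egr_rational_j (d : nat) : Prop :=
  exists E : weier, [/\ ell_over d E, everywhere_good d E & jinv E \in Crat].

(* Main.v *)
Require Import Defs.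
From Stdlib Require Import Reals Classical_Prop.
From mathcomp Require Import all_boot all_order all_fingroup all_algebra.
From mathcomp Require Import all_solvable all_field Rstruct.
From mathcomp Require Import zify ring lra.
Set Implicit Arguments. Unset Strict Implicit. Unset Printing Implicit Defensive.
Import Order.TTheory GRing.Theory Num.Theory.
Local Open Scope ring_scope.

(* Let n = 1 (mod 4) be a squarefree product of primes p = 1, 2, 4 (mod 7),
   p odd, and d = 7n.  Each such p splits in Q(sqrt(-7)) and is of the form
   7x^2 + z^2, hence so is n.  Put w = sqrt d and u = 7x + w; the norm of u is
   -7z^2, so the ideal of u is the prime above 7 times a square, and 2u becomes
   a square modulo 4 after scaling by a square at the prime above 2.  Twisting by
   2u the curve of conductor 49 with j = -3375 therefore removes its bad reduction
   at 7 and creates none elsewhere.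

   Counting: let chi be the quadratic character mod 7 and S the set of the n
   above, without the congruence mod 4.  Since the partial sums of
   L(1, chi) are at least 1/2, log N is at most a constant times the sum of
   (1 * chi)(n) / n over n <= N, and this is at most a constant times F(N)^2,
   where F(N) is the sum of 1/m over the m <= N in S.  Mertens' method for the
   trivial character and chi gives a lower Chebyshev bound for the primes dividing
   elements of S.  Weighting n in S by log n, and writing n = pm, one gets
   |S(N)| log N >> N F(N^(1/3)) >> N sqrt(log N).  Finally, multiplying or
   dividing by 11 moves the n = 3 (mod 4) to the class n = 1 (mod 4). *)

(** * Everywhere good reduction over Q(sqrt(7n)) *)

Lemma qfield_rat d (a : rat) : qfield d (ratr a).
Proof. by exists a, 0; rewrite rmorph0 mul0r addr0. Qed.

Lemma qfield_nat d (k : nat) : qfield d k%:R.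
Proof. by rewrite -(rmorph_nat (@ratr algC)); apply: qfield_rat. Qed.

Lemma qfield_sqrt d : qfield d (sqrtC d%:R).
Proof. by exists 0, 1; rewrite rmorph0 rmorph1 mul1r add0r. Qed.

Lemma qfieldD d x y : qfield d x -> qfield d y -> qfield d (x + y).
Proof.
by move=> [a [b ->]] [a' [b' ->]]; exists (a + a'), (b + b'); rewrite !rmorphD /=; ring.
Qed.

Lemma qfieldN d x : qfield d x -> qfield d (- x).
Proof. by move=> [a [b ->]]; exists (- a), (- b); rewrite !rmorphN /=; ring. Qed.

Lemma qfieldM d x y : qfield d x -> qfield d y -> qfield d (x * y).
Proof.
move=> [a [b ->]] [a' [b' ->]]; exists (a * a' + b * b' * d%:R), (a * b' + a' * b).
rewrite !rmorphD !rmorphM /= rmorph_nat.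
have hs := sqrtCK (d%:R : algC); set s := sqrtC _ in hs *.
by rewrite -hs; ring.
Qed.

Lemma qfieldX d x k : qfield d x -> qfield d (x ^+ k).
Proof.
move=> hx; elim: k => [|k IH]; first exact: (qfield_nat d 1).
by rewrite exprS; apply: qfieldM.
Qed.

Lemma qfield_natV d (k : nat) : qfield d k%:R^-1.
Proof. by rewrite -(rmorph_nat (@ratr algC)) -fmorphV; apply: qfield_rat. Qed.

Lemma qint_nat d (k : nat) : qint d k%:R.
Proof. by split; [apply: qfield_nat | rewrite rpred_nat]. Qed.

Lemma qintD d x y : qint d x -> qint d y -> qint d (x + y).
Proof. by move=> [? ?] [? ?]; split; [apply: qfieldD | apply: rpredD]. Qed.

Lemma qintN d x : qint d x -> qint d (- x).
Proof. by move=> [? ?]; split; [apply: qfieldN | rewrite rpredN]. Qed.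

Lemma qintM d x y : qint d x -> qint d y -> qint d (x * y).
Proof. by move=> [? ?] [? ?]; split; [apply: qfieldM | apply: rpredM]. Qed.

Lemma qint_sqrt d : qint d (sqrtC d%:R).
Proof.
split; first exact: qfield_sqrt.
apply: (@root_monic_Aint ('X^2 - d%:R%:P)).
- by rewrite /root !hornerE sqrtCK subrr.
- by apply/monicP; rewrite lead_coefDl ?lead_coefXn // size_polyN size_polyXn ltnS (leq_trans (size_polyC_leq1 _)).
- by rewrite polyOverXnsubC rpred_nat.
Qed.

(** * Localization of the ring of integers at a prime ideal *)

Section LocalRing.
Variables (d : nat) (P : algC -> Prop).
Hypothesis hP : is_prime_ideal d P.

Lemma prime_ideal0 : P 0. Proof. by case: hP => _ []. Qed.
Lemma prime_ideal1 : ~ P 1. Proof. by case: hP => _ [_ [_ [_ [_ []]]]]. Qed.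
Lemma prime_idealD x y : P x -> P y -> P (x + y).
Proof. by case: hP => _ [_ [h _]]; apply: h. Qed.
Lemma prime_idealMl r x : qint d r -> P x -> P (r * x).
Proof. by case: hP => _ [_ [_ [h _]]]; apply: h. Qed.
Lemma prime_idealN x : P x -> P (- x).
Proof. by rewrite -mulN1r; apply: prime_idealMl; apply/qintN/(qint_nat d 1). Qed.
Lemma prime_idealMP x y : qint d x -> qint d y -> P (x * y) -> P x \/ P y.
Proof. by case: hP => _ [_ [_ [_ [_ [_ h]]]]]; apply: h. Qed.
Lemma prime_ideal_coprime (a b : nat) : coprime a b -> P a%:R -> P b%:R -> False.
Proof.
case: (posnP a) => [-> | a0] cab ha hb.
  by move: cab; rewrite /coprime gcd0n => /eqP b1; move: hb; rewrite b1; apply: prime_ideal1.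
case: (@egcdnP a b a0) => u v e _; apply: prime_ideal1.
have -> : 1 = u%:R * a%:R + - (v%:R * b%:R) :> algC.
  by rewrite -!natrM e (eqP cab) natrD addrAC subrr add0r.
by apply: prime_idealD; [|apply: prime_idealN]; apply: prime_idealMl => //; apply: qint_nat.
Qed.

Lemma notP_neq0 z : ~ P z -> z != 0.
Proof. by move=> h; apply/eqP => z0; apply: h; rewrite z0; apply: prime_ideal0. Qed.

Lemma notPM x y : qint d x -> qint d y -> ~ P x -> ~ P y -> ~ P (x * y).
Proof. by move=> hx hy nx ny /(prime_idealMP hx hy) []. Qed.

Lemma loc_int_qint x : qint d x -> loc_int d P x.
Proof.
by move=> h; exists x, 1; split; rewrite ?divr1 //; [apply: (qint_nat d 1) | apply: prime_ideal1].
Qed.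

Lemma loc_intD x y : loc_int d P x -> loc_int d P y -> loc_int d P (x + y).
Proof.
move=> [a [b [ha hb nb ->]]] [a' [b' [ha' hb' nb' ->]]].
exists (a * b' + a' * b), (b * b'); split.
- by apply: qintD; apply: qintM.
- exact: qintM.
- exact: notPM.
- by rewrite addf_div ?notP_neq0.
Qed.

Lemma loc_intM x y : loc_int d P x -> loc_int d P y -> loc_int d P (x * y).
Proof.
move=> [a [b [ha hb nb ->]]] [a' [b' [ha' hb' nb' ->]]].
exists (a * a'), (b * b'); split; try exact: qintM; first exact: notPM.
by rewrite mulf_div.
Qed.

Lemma loc_intN x : loc_int d P x -> loc_int d P (- x).
Proof. by move=> [a [b [ha hb nb ->]]]; exists (- a), b; split; rewrite ?mulNr //; apply: qintN. Qed.

Lemma loc_int_nat (k : nat) : loc_int d P k%:R.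
Proof. exact/loc_int_qint/qint_nat. Qed.

Lemma loc_intX x k : loc_int d P x -> loc_int d P (x ^+ k).
Proof.
move=> hx; elim: k => [|k IH]; first exact: (loc_int_nat 1).
by rewrite exprS; apply: loc_intM.
Qed.

Lemma loc_unit_qint x : qint d x -> ~ P x -> loc_unit d P x.
Proof.
move=> hx nx; split; [exact: loc_int_qint | split; first exact: notP_neq0].
by exists 1, x; split; rewrite ?div1r //; apply: (qint_nat d 1).
Qed.

Lemma loc_unitM x y : loc_unit d P x -> loc_unit d P y -> loc_unit d P (x * y).
Proof.
move=> [hx [x0 hx']] [hy [y0 hy']]; split; [exact: loc_intM | split].
  by rewrite mulf_neq0.
by rewrite invfM; apply: loc_intM.
Qed.

Lemma loc_unitN x : loc_unit d P x -> loc_unit d P (- x).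
Proof.
move=> [hx [x0 hx']]; split; [exact: loc_intN | split; first by rewrite oppr_eq0].
by rewrite invrN; apply: loc_intN.
Qed.

Lemma loc_unitV x : loc_unit d P x -> loc_unit d P x^-1.
Proof. by move=> [hx [x0 hx']]; split => //; split; rewrite ?invr_eq0 ?invrK. Qed.

Lemma loc_unitX x k : loc_unit d P x -> loc_unit d P (x ^+ k).
Proof.
move=> hx; elim: k => [|k IH]; last by rewrite exprS; apply: loc_unitM.
by apply: loc_unit_qint; [apply: (qint_nat d 1) | apply: prime_ideal1].
Qed.

Lemma loc_unit_nat (a b : nat) : P a%:R -> coprime a b -> loc_unit d P b%:R.
Proof.
move=> ha cab; apply: loc_unit_qint; first exact: qint_nat.
exact: prime_ideal_coprime cab ha.
Qed.

End LocalRing.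

(* The curve with j = -3375 and complex multiplication by Z[(1+sqrt(-7))/2],
   twisted by t. *)
Definition cm7_twist (t : algC) : weier :=
  Weier 0 0 0 (- (35 * t ^+ 2)) (- (98 * t ^+ 3)).

Lemma wdisc_short (a b : algC) :
  wdisc (Weier 0 0 0 a b) = - 16 * (4 * a ^+ 3 + 27 * b ^+ 2).
Proof. by rewrite /wdisc /wb2 /wb4 /wb6 /wb8 /=; ring. Qed.

Lemma wdisc_cm7_twist t : wdisc (cm7_twist t) = - (2 ^ 12 * 343)%:R * t ^+ 6.
Proof. by rewrite wdisc_short; ring. Qed.

Lemma jinv_cm7_twist t : t != 0 -> jinv (cm7_twist t) = - 3375.
Proof.
move=> t0; rewrite /jinv wdisc_cm7_twist /wc4 /wb2 /wb4 /=.
field. by rewrite t0.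
Qed.

Lemma wchange_scale (a b u : algC) : u != 0 ->
  wchange (Weier 0 0 0 a b) u 0 0 0 = Weier 0 0 0 (a / u ^+ 4) (b / u ^+ 6).
Proof. by move=> u0; rewrite /wchange /=; congr Weier; field. Qed.

Lemma good_red_at_scale d P a b u : is_prime_ideal d P -> qfield d u -> u != 0 ->
  loc_int d P (a / u ^+ 4) -> loc_int d P (b / u ^+ 6) ->
  loc_unit d P (- 16 * (4 * (a / u ^+ 4) ^+ 3 + 27 * (b / u ^+ 6) ^+ 2)) ->
  good_red_at d (Weier 0 0 0 a b) P.
Proof.
move=> hP hu u0 ha hb hD; exists u, 0, 0, 0.
have q0 : qfield d 0 by apply: (qfield_nat d 0).
have l0 : loc_int d P 0 by apply: (loc_int_nat hP 0).
split; first by split.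
by rewrite wchange_scale //= wdisc_short; split.
Qed.

Lemma div_mul_eq (F : fieldType) (a b c : F) : b != 0 -> a = c * b -> a / b = c.
Proof. by move=> b0 ->; rewrite mulfK. Qed.

(* Parameters: d = 7n with n = 4e + 1 = 28y^2 + z^2.  With w = sqrt d and
   u = w + 14y, the norm of u is -7z^2 and the twist is by t = 2u.  *)
Section EverywhereGood.
Variables e y z g : nat.
Hypothesis hn : (4 * e + 1 = 28 * y ^ 2 + z ^ 2)%N.
Hypothesis hg : (y + e = 2 * g)%N.
Hypothesis z_odd : odd z.
Hypothesis cop7 : coprime 7 (4 * e + 1).
Hypothesis copy : coprime (14 * y) (4 * e + 1).

Let n := (4 * e + 1)%N.
Let d := (7 * n)%N.
Let w : algC := sqrtC d%:R.
Let E : algC := e%:R.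
Let Y : algC := y%:R.
Let Z : algC := z%:R.
Let u := w + 14 * Y.
Let ubar := 14 * Y - w.
Let t := 2 * u.

Let hw : w ^+ 2 = 7 * (4 * E + 1).
Proof. by rewrite /w sqrtCK /d /n natrM natrD natrM. Qed.

Let hZ : Z ^+ 2 = 4 * E + 1 - 28 * Y ^+ 2.
Proof.
have h : (4 * e + 1)%:R = (28 * y ^ 2 + z ^ 2)%:R :> algC by rewrite hn.
move: h; rewrite natrD natrD (natrM _ 4) (natrM _ 28) !natrX -/E -/Y -/Z => ->.
by rewrite addrC addKr.
Qed.

Let norm_u : u * ubar = - 7 * Z ^+ 2.
Proof. by rewrite hZ; transitivity (196 * Y ^+ 2 - w ^+ 2); [rewrite /u /ubar; ring | rewrite hw; ring]. Qed.

Let Z0 : Z != 0.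
Proof. by rewrite pnatr_eq0 -lt0n odd_gt0. Qed.

Let u0 : u != 0.
Proof.
apply/eqP => h; move/eqP: norm_u; rewrite h mul0r eq_sym mulf_eq0 expf_eq0 (negPf Z0) andbF orbF.
by rewrite oppr_eq0 (pnatr_eq0 _ 7).
Qed.

Let qw : qint d w. Proof. exact: qint_sqrt. Qed.
Let qu : qint d u.
Proof. by apply: qintD => //; apply: qintM; [apply: (qint_nat d 14) | apply: qint_nat]. Qed.
Let qubar : qint d ubar.
Proof.
by apply: qintD; [apply: qintM; [apply: (qint_nat d 14) | apply: qint_nat] | apply: qintN].
Qed.

Section AtPrime.
Variable P : algC -> Prop.
Hypothesis hP : is_prime_ideal d P.

(** Away from 2 and 7 the short equation twisted by a unit at [P] is already good: its discriminant
    is [- 2 ^ 12 * 7 ^ 3 * s ^ 6]. *)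
Let loc_disc s : ~ P 2%:R -> ~ P 7%:R -> qint d s -> ~ P s ->
  [/\ loc_int d P (- (35 * s ^+ 2)), loc_int d P (- (98 * s ^+ 3)) &
    loc_unit d P (- 16 * (4 * (- (35 * s ^+ 2)) ^+ 3 + 27 * (- (98 * s ^+ 3)) ^+ 2))].
Proof.
move=> n2 n7 qs ns; have ls := loc_int_qint hP qs.
split.
- by apply: loc_intN; apply: (loc_intM hP); [apply: (loc_int_nat hP 35) | apply: (loc_intX hP)].
- by apply: loc_intN; apply: (loc_intM hP); [apply: (loc_int_nat hP 98) | apply: (loc_intX hP)].
rewrite [X in loc_unit _ _ X](_ : _ = - (2%:R ^+ 12 * 7%:R ^+ 3 * s ^+ 6)); last by ring.
apply: loc_unitN; apply: (loc_unitM hP); last exact/(loc_unitX hP)/loc_unit_qint.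
by apply: (loc_unitM hP); apply: (loc_unitX hP); apply: (loc_unit_qint hP) => //; apply: qint_nat.
Qed.

(** If [u] lies in [P], then [ubar] does not, and the norm relation writes [t] as the square of
    [u / (7 * Z)] times [- (14 * ubar)], a unit at [P]. Otherwise [t] is itself a unit. *)
Lemma good_red_generic : ~ P 2%:R -> ~ P 7%:R -> good_red_at d (cm7_twist t) P.
Proof.
move=> n2 n7.
have qk k : qint d k%:R by apply: qint_nat.
have n14 : ~ P 14%:R by rewrite (natrM _ 2 7); apply: (notPM hP).
have [Pu|nu] : P u \/ ~ P u by apply: classic.
  (* Otherwise [P] contains [14 * y] and [w], hence also [n], against [copy]. *)
  have nub : ~ P ubar.
    move=> Pub.
    have P28Y : P (2%:R * (14 * y)%:R).
      have -> : 2%:R * (14 * y)%:R = u + ubar :> algC by rewrite natrM /u /ubar -/Y; ring.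
      exact: (prime_idealD hP).
    have P2w : P (2%:R * w).
      have -> : 2%:R * w = u + - ubar by rewrite /u /ubar; ring.
      by apply: (prime_idealD hP) => //; apply: (prime_idealN hP).
    have {P28Y} Py : P (14 * y)%:R by case: (prime_idealMP hP (qk _) (qk _) P28Y).
    have {P2w} Pw : P w by case: (prime_idealMP hP (qk _) qw P2w).
    have : P (7%:R * n%:R).
      by rewrite -natrM -/d -(sqrtCK d%:R) -/w expr2; apply: (prime_idealMl hP).
    by case/(prime_idealMP hP (qk _) (qk _)) => // Pn; apply: (prime_ideal_coprime hP copy Py Pn).
  have qs : qint d (- (14%:R * ubar)) by apply/qintN/qintM.
  have ns : ~ P (- (14%:R * ubar)).
    by move/(prime_idealN hP); rewrite opprK; apply: (notPM hP).
  have [ha hb hD] := loc_disc n2 n7 qs ns.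
  have ub0 : ubar != 0 := notP_neq0 hP nub.
  have v0 : u / (7 * Z) != 0 by rewrite !mulf_neq0 ?invr_eq0 ?mulf_neq0 // (pnatr_eq0 _ 7).
  have tE : t = (u / (7 * Z)) ^+ 2 * - (14 * ubar).
    rewrite /t; apply: (mulfI ub0); apply: (mulfI (expf_neq0 2 Z0)).
    have -> : Z ^+ 2 * (ubar * (2 * u)) = 2 * Z ^+ 2 * (u * ubar) by ring.
    have -> : Z ^+ 2 * (ubar * ((u / (7 * Z)) ^+ 2 * - (14 * ubar))) = - (2 / 7) * (u * ubar) ^+ 2.
      by field.
    by rewrite norm_u; field.
  apply: (good_red_at_scale hP (u := u / (7 * Z))) => //.
  - apply: qfieldM; first by case: qu.
    by rewrite -natrM; apply: qfield_natV.
  - by rewrite (div_mul_eq _ (c := - (35 * (- (14%:R * ubar)) ^+ 2))) ?expf_neq0 // tE; ring.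
  - by rewrite (div_mul_eq _ (c := - (98 * (- (14%:R * ubar)) ^+ 3))) ?expf_neq0 // tE; ring.
  - rewrite (div_mul_eq _ (c := - (35 * (- (14%:R * ubar)) ^+ 2))) ?expf_neq0 //; last by rewrite tE; ring.
    by rewrite (div_mul_eq _ (c := - (98 * (- (14%:R * ubar)) ^+ 3))) ?expf_neq0 // tE; ring.
have qt : qint d t by apply: qintM.
have nt : ~ P t by apply: (notPM hP).
have [ha hb hD] := loc_disc n2 n7 qt nt.
apply: (good_red_at_scale hP (u := 1)); rewrite ?expr1n ?divr1 ?oner_neq0 //.
exact: (qfield_nat d 1).
Qed.

(** Here [w] is a uniformizer and [t] is [2 * w] times the unit [o]. The discriminant has valuation
    6 from [343] and 6 from [t ^ 6]; scaling by [w] removes all 12. *)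
Lemma good_red_at7 : P 7%:R -> good_red_at d (cm7_twist t) P.
Proof.
move=> P7.
have qk k : qint d k%:R by apply: qint_nat.
have nn : ~ P n%:R by move/(prime_ideal_coprime hP cop7 P7).
have n2 : ~ P 2%:R by move/(prime_ideal_coprime hP (isT : coprime 7 2) P7).
have Pw : P w.
  have : P (w * w) by rewrite -expr2 sqrtCK /d natrM mulrC; apply: (prime_idealMl hP).
  by case/(prime_idealMP hP qw qw).
have n0 : n%:R != 0 :> algC := notP_neq0 hP nn.
have w0 : w != 0 by rewrite sqrtC_eq0 /d natrM mulf_neq0 // (pnatr_eq0 _ 7).
have hwn : w ^+ 2 = 7 * n%:R by rewrite /w sqrtCK /d natrM.
have qv : qint d (n%:R + 2%:R * y%:R * w) by apply: (qintD (qk n)); apply: qintM => //; apply: qintM.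
have nv : ~ P (n%:R + 2%:R * y%:R * w).
  move=> h; apply: nn.
  rewrite -[n%:R](addrK (2%:R * y%:R * w)); apply: (prime_idealD hP) => //.
  by apply: (prime_idealN hP); apply: (prime_idealMl hP) => //; apply: (qintM (qk 2) (qk y)).
(* Since [w ^ 2 = 7 * n], the product [w * o] is [w + 14 * y], that is [u]. *)
pose o := (n%:R + 2%:R * y%:R * w) / n%:R.
have uo : loc_unit d P o.
  by apply: (loc_unitM hP); [|apply: loc_unitV]; apply: (loc_unit_qint hP).
have un : loc_unit d P n%:R^-1 by apply: loc_unitV; apply: (loc_unit_qint hP).
have tE : t = 2 * (w * o).
  congr (2 * _); rewrite /u /o.
  have -> : w * ((n%:R + 2%:R * y%:R * w) / n%:R) = (w * n%:R + 2 * Y * w ^+ 2) / n%:R by rewrite /Y; ring.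
  by rewrite hwn; field.
have w4 : w ^+ 4 = 49 * n%:R ^+ 2 by rewrite (exprM w 2 2) hwn; ring.
have w6 : w ^+ 6 = 343 * n%:R ^+ 3 by rewrite (exprM w 2 3) hwn; ring.
have aE : - (35 * t ^+ 2) / w ^+ 4 = - (20%:R * (o ^+ 2 * n%:R^-1)).
  rewrite tE w4.
  have -> : - (35 * (2 * (w * o)) ^+ 2) = - (140 * w ^+ 2 * o ^+ 2) by ring.
  by rewrite hwn; field.
have bE : - (98 * t ^+ 3) / w ^+ 6 = - (16%:R * (o ^+ 3 * n%:R^-1 ^+ 2 * w)).
  rewrite tE w6.
  have -> : - (98 * (2 * (w * o)) ^+ 3) = - (784 * w ^+ 2 * w * o ^+ 3) by ring.
  by rewrite hwn; field.
have dE : - 16 * (4 * (- (20%:R * (o ^+ 2 * n%:R^-1))) ^+ 3 +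
     27 * (- (16%:R * (o ^+ 3 * n%:R^-1 ^+ 2 * w))) ^+ 2) = - (2%:R ^+ 18 * (o ^+ 6 * n%:R^-1 ^+ 3)) :> algC.
  have -> : (- (16%:R * (o ^+ 3 * n%:R^-1 ^+ 2 * w))) ^+ 2 = 256 * o ^+ 6 * n%:R^-1 ^+ 4 * w ^+ 2 by ring.
  by rewrite hwn; field.
apply: (good_red_at_scale hP (u := w)) => //; rewrite ?aE ?bE ?dE.
- by case: qw.
- apply: loc_intN; apply: (loc_intM hP); first exact: loc_int_nat.
  by apply: (loc_intM hP); [apply: (loc_intX hP); case: uo | case: un].
- apply: loc_intN; apply: (loc_intM hP); first exact: loc_int_nat.
  apply: (loc_intM hP); last exact: loc_int_qint.
  by apply: (loc_intM hP); apply: (loc_intX hP); [case: uo | case: un].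
- apply: loc_unitN; apply: (loc_unitM hP).
    by apply: (loc_unitX hP); apply: (loc_unit_qint hP).
  by apply: (loc_unitM hP); apply: (loc_unitX hP).
Qed.

(** Up to a square, [t] is [s], a unit congruent to the square [w ^ 2] modulo 4, so the twist is
    unramified at 2. The final equation is the twist by [s] of [y^2 + xy = x^3 - x^2 - 2x - 1]: its
    [wb2] is [- 3 * s], and taking [a1 = w] makes [a2] integral. *)
Lemma good_red_at2 : P 2%:R -> good_red_at d (cm7_twist t) P.
Proof.
move=> P2.
have qk k : qint d k%:R by apply: qint_nat.
(* Determined by [u * (k + w) = w ^ 2 + 4 * kap] with [k = 14 * e + 4]; the coefficient of [w] is
   [k + 14 * y = 4 * (7 * g + 1)] because [y + e = 2 * g]. *)
pose kap : algC := (7 * y * (7 * e + 2))%:R + (7 * g + 1)%:R * w.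
have qkap : qint d kap by apply: qintD; [|apply: qintM].
pose s := w ^+ 2 + 4 * kap.
have ws : w ^+ 2 = (7 * n)%:R by rewrite /w sqrtCK.
have qs : qint d s by rewrite /s ws; apply: qintD => //; apply: (qintM (qk 4)).
have us : loc_unit d P s.
  apply: (loc_unit_qint hP) => // Ps.
  apply: (@prime_ideal_coprime _ _ hP 2 (7 * n)) => //.
    by rewrite coprime2n oddM /n addn1 /= oddM.
  rewrite -ws -[w ^+ 2](addrK (4 * kap)) -/s; apply: (prime_idealD hP) => //.
  apply: (prime_idealN hP); rewrite mulrC (natrM _ 2 2) mulrA; apply: (prime_idealMl hP) => //.
  exact: qintM.
have hg' : Y + E = 2 * g%:R by rewrite /Y /E -natrD hg natrM.
have [k kE'] : exists k : algC, k = (14 * e + 4)%:R by exists (14 * e + 4)%:R.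
have kE : k = 14 * E + 4 by rewrite kE' natrD natrM.
have sE : s = u * (k + w).
  rewrite /s /kap kE !(natrD, natrM) -/E -/Y /u.
  have -> : 4 * (7 * Y * (7 * E + 2) + (7 * g%:R + 1) * w) = 4 * (7 * Y * (7 * E + 2)) + (14 * (2 * g%:R) + 4) * w by ring.
  by rewrite -hg'; ring.
have [N NE] : exists N : algC, N = (14 * e + 3)%:R by exists (14 * e + 3)%:R.
(* The norm of [k + w] is a square, and [2 * (k + w)] is the square of [1 + w]; hence [2 * u] and
   [u * (k + w)] differ by a square. *)
have nk : (k + w) * (k - w) = N ^+ 2.
  transitivity (k ^+ 2 - w ^+ 2); first ring.
  by rewrite hw kE NE natrD natrM -/E; ring.
have N0 : N != 0 by rewrite NE pnatr_eq0 addnC.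
have [kw0 kw0'] : k + w != 0 /\ k - w != 0.
  by apply/andP; rewrite -negb_or -mulf_eq0 nk expf_eq0 negb_and N0 orbT.
have k1w : (1 + w) ^+ 2 = 2 * (k + w).
  by transitivity (1 + 2 * w + w ^+ 2); [ring | rewrite hw kE; ring].
pose v := (1 + w) * (k - w) * N^-1 ^+ 2.
have v0 : v != 0.
  rewrite !mulf_neq0 ?expf_neq0 ?invr_eq0 //.
  by apply/eqP => h; move/eqP: k1w; rewrite h expr0n /= eq_sym mulf_eq0 (pnatr_eq0 _ 2) (negPf kw0).
have tE : t = v ^+ 2 * s.
  rewrite /v.
  have -> : ((1 + w) * (k - w) * N^-1 ^+ 2) ^+ 2 * s =
     (1 + w) ^+ 2 * (k - w) ^+ 2 * (N ^+ 2)^-1 ^+ 2 * s by field.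
  rewrite -nk k1w sE /t; field; rewrite ?kw0 ?kw0' //.
have qfv : qfield d v.
  have [qw1 _] := qw.
  apply: qfieldM; last by rewrite NE; apply/qfieldX/qfield_natV.
  apply: qfieldM; first by apply: (qfieldD (qfield_nat d 1)).
  by rewrite kE'; apply: (qfieldD (qfield_nat d _)); apply: qfieldN.
(* For the untwisted curve this is [x = 4x' - 1], which leads from the short equation to the one of
   discriminant [- 343]; [v] absorbs the square factor of the twist. *)
exists (2 * v), (- t), (v * w), 0.
have qft : qfield d t by case: (qintM (qk 2) qu).
split.
  split; first by apply: qfieldM => //; apply: (qfield_nat d 2).
  - by rewrite mulf_neq0 // (pnatr_eq0 _ 2).
  - exact: qfieldN.
  - by apply: qfieldM => //; case: qw.
  - exact: (qfield_nat d 0).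
have -> : wchange (cm7_twist t) (2 * v) (- t) (v * w) 0 =
   Weier w (- (w ^+ 2 + 3 * kap)) 0 (- (2 * s ^+ 2)) (- s ^+ 3).
  by rewrite /wchange /= tE /s; congr Weier; field.
have lw : loc_int d P w by apply: loc_int_qint.
have lk : loc_int d P kap by apply: loc_int_qint.
have ls : loc_int d P s by case: us.
split; first split => /=.
- exact: lw.
- apply: loc_intN; apply: (loc_intD hP); first exact: loc_intX.
  by apply: (loc_intM hP) => //; apply: (loc_int_nat hP 3).
- exact: (loc_int_nat hP 0).
- by apply: loc_intN; apply: (loc_intM hP); [apply: (loc_int_nat hP 2) | apply: (loc_intX hP)].
- by apply: loc_intN; apply: (loc_intX hP).
have -> : wdisc (Weier w (- (w ^+ 2 + 3 * kap)) 0 (- (2 * s ^+ 2)) (- s ^+ 3)) = - (343%:R * s ^+ 6).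
  by rewrite /wdisc /wb2 /wb4 /wb6 /wb8 /= /s; ring.
apply: loc_unitN; apply: (loc_unitM hP); last exact: loc_unitX.
exact: (loc_unit_nat hP P2).
Qed.

End AtPrime.

Lemma egr_param : has_egr_rational_j d.
Proof.
have t0 : t != 0 by rewrite mulf_neq0 // (pnatr_eq0 _ 2).
have qft : qfield d t by case: (qintM (qint_nat d 2) qu).
exists (cm7_twist t); split.
- split; last first.
    by rewrite wdisc_cm7_twist mulf_neq0 ?expf_neq0 // oppr_eq0 pnatr_eq0.
  split=> /=; try exact: (qfield_nat d 0).
  + by apply/qfieldN/qfieldM; [apply: (qfield_nat d 35) | apply: qfieldX].
  + by apply/qfieldN/qfieldM; [apply: (qfield_nat d 98) | apply: qfieldX].
- move=> P hP.
  have [P2|n2] := classic (P 2%:R); first exact: good_red_at2.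
  have [P7|n7] := classic (P 7%:R); first exact: good_red_at7.
  exact: good_red_generic.
- rewrite jinv_cm7_twist //.
  by rewrite rpredN rpred_nat.
Qed.
End EverywhereGood.

(** * The form 7x^2 + z^2 *)

(** The images of [0, ..., p - 1] are already [p] roots of [X^p - X], so a further root [h] would be
    one too many. *)
Lemma frobenius_fixed_nat (p : nat) (F : finFieldType) (h : F) :
  p \in [pchar F] -> h ^+ p = h -> exists a : nat, h = a%:R.
Proof.
move=> pF hp; have p_pr := pcharf_prime pF.
pose s := [seq i%:R : F | i <- iota 0 p].
have [/mapP[a _ ->]|hs] := boolP (h \in s); first by exists a.
pose q : {poly F} := 'X^p - 'X.
have sq : size q = p.+1.
  by rewrite size_polyDl size_polyXn // size_polyN size_polyX ltnS prime_gt1.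
have rootq x : x ^+ p = x -> root q x by move=> xp; rewrite /root !hornerE xp subrr.
have us : uniq (h :: s).
  rewrite /= hs map_inj_in_uniq ?iota_uniq // => i j; rewrite !mem_iota /= !add0n.
  wlog le_ij : i j / (i <= j)%N => [wl ip jp e|].
    by case/orP: (leq_total i j) => ij; [apply: wl | apply/esym/wl].
  move=> ip jp /eqP; rewrite eq_sym -subr_eq0 -natrB // -(dvdn_pcharf pF) => dv.
  case: (posnP (j - i)) dv => [|gt0 /(dvdn_leq gt0)]; lia.
have := @max_poly_roots _ q (h :: s); rewrite us sq /= size_map size_iota ltnn.
move=> H; suff : false by []; apply: H => //; first by rewrite -size_poly_gt0 sq.
rewrite rootq //=; apply/allP => _ /mapP[i _ ->]; apply: rootq.
by rewrite -!(pFrobenius_autE pF) pFrobenius_aut_nat.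
Qed.

(* For a primitive 7th root of unity z in characteristic p, the Gauss period
   g = z + z^2 + z^4 satisfies (2g + 1)^2 = -7, and Frobenius fixes g. *)
Lemma neg7_square_mod (p : nat) : prime p -> (p %% 7)%N \in [:: 1; 2; 4]%N ->
  exists a : nat, (p %| a ^ 2 + 7)%N.
Proof.
move=> p_pr hp7.
(* The class of [p] modulo 7 has order dividing 3, so 7 divides [p ^ 3 - 1] and the field with
   [p ^ 3] elements contains a primitive 7th root of unity. *)
have [F pF cF] := PrimePowerField p_pr (isT : 0 < 3)%N.
have d7 : (7 %| #|[set: {unit F}]|)%N.
  rewrite card_finField_unit cF -subn1 -eqn_mod_dvd ?expn_gt0 ?prime_gt0 //.
  by rewrite -modnXm; move: hp7; rewrite !inE => /or3P[] /eqP->.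
have [x _ ox] := Cauchy (isT : prime 7) d7.
pose z : F := val x.
have z7 : z ^+ 7 = 1 by rewrite -FinRing.val_unitX -ox expg_order.
have z1 : z != 1.
  apply: contraTneq (isT : prime 7) => z1; rewrite -ox.
  by have -> : x = 1%g; [apply: val_inj | rewrite order1].
have zsum : 1 + z + z ^+ 2 + z ^+ 3 + z ^+ 4 + z ^+ 5 + z ^+ 6 = 0.
  have z10 : z - 1 != 0 by rewrite subr_eq0.
  by apply: (mulfI z10); rewrite mulr0; transitivity (z ^+ 7 - 1); [ring | rewrite z7 subrr].
pose g := z + z ^+ 2 + z ^+ 4.
have z8 : z ^+ 8 = z by rewrite exprSr z7 mul1r.
have gg : (2 * g + 1) ^+ 2 = - 7.
  have -> : (2 * g + 1) ^+ 2 = 8 * (1 + z + z ^+ 2 + z ^+ 3 + z ^+ 4 + z ^+ 5 + z ^+ 6)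
     + 4 * (z ^+ 8 - z) - 7 by rewrite /g; ring.
  by rewrite zsum z8 subrr !mulr0 !add0r.
(* Multiplication by [p] permutes the exponents 1, 2, 4 modulo 7. *)
have gp : g ^+ p = g.
  rewrite -(pFrobenius_autE pF) /g !rmorphD !rmorphXn /= pFrobenius_autE.
  have -> : z ^+ p = z ^+ (p %% 7) by rewrite {1}(divn_eq p 7) exprD mulnC exprM z7 expr1n mul1r.
  have z16 : z ^+ 16 = z ^+ 2 by rewrite (exprM z 8 2) z8.
  move: hp7; rewrite !inE => /or3P[] /eqP->; rewrite -?exprM ?expr1 ?z8 ?z16; ring.
have [a ha] : exists a : nat, 2 * g + 1 = a%:R.
  apply: (frobenius_fixed_nat pF).
  by rewrite -(pFrobenius_autE pF) rmorphD rmorphM rmorph1 rmorph_nat /= pFrobenius_autE gp.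
exists a; rewrite (dvdn_pcharf pF) natrD natrX -ha gg; apply/eqP; ring.
Qed.

(* Thue's pigeonhole argument. *)
Lemma small_norm_multiple (p a : nat) : prime p -> (p %| a ^ 2 + 7)%N ->
  exists r s : nat, [/\ (p %| r ^ 2 + 7 * s ^ 2)%N, (0 < r + s)%N, (r ^ 2 < p)%N & (s ^ 2 < p)%N].
Proof.
move=> p_pr pa.
have [m [mp pm]] : exists m, (m ^ 2 <= p)%N /\ (p < m.+1 ^ 2)%N.
  have ex0 : exists m, (m ^ 2 <= p)%N by exists 0%N.
  have ub m : (m ^ 2 <= p)%N -> (m <= p)%N by nia.
  exists (ex_maxn ex0 ub); case: ex_maxnP => m hm mx; split => //.
  by rewrite ltnNge; apply/negP => /mx; rewrite ltnn.
(* A prime is not a square, which makes the final bounds strict. *)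
have mp' : (m ^ 2 < p)%N.
  rewrite ltn_neqAle mp andbT; apply/eqP => h.
  have /primeP[p1 /(_ m)] := p_pr; rewrite -h => H.
  have : (m %| m ^ 2)%N by rewrite dvdn_exp.
  move/H => /orP[] /eqP; nia.
have p0 := prime_gt0 p_pr.
(* This is [u - a * v] modulo [p], shifted by [a * m] to stay natural. The domain has more than [p]
   elements, and a collision gives differences with [X = a * Y] modulo [p]. *)
pose f (u : 'I_m.+1 * 'I_m.+1) : 'I_p := Ordinal (ltn_pmod (u.1 + a * (m - u.2)) p0).
have : ~~ injectiveb f.
  apply/injectiveP => /leq_card; rewrite card_prod !card_ord leqNgt => /negP[].
  by rewrite mulnn.
case/injectivePn => -[u v] [[u' v'] ne /(congr1 val) /= e].
have um := ltn_ord u; have vm := ltn_ord v; have um' := ltn_ord u'; have vm' := ltn_ord v'.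
have {}ne : (u != u' :> nat) || (v != v' :> nat).
  by rewrite -negb_and; apply: contra ne => /andP[/eqP h1 /eqP h2]; apply/eqP; congr (_, _); apply: val_inj.
have /dvdnP[c hc] := pa.
have small (i j : 'I_m.+1) : (`|i%:Z - j%:Z| ^ 2 < p)%N.
  have im := ltn_ord i; have jm := ltn_ord j.
  by apply: leq_ltn_trans mp'; rewrite leq_sqr; lia.
exists `|u%:Z - u'%:Z|%N, `|v%:Z - v'%:Z|%N; split=> //; last by clear -ne; lia.
have e1 := divn_eq (u + a * (m - v)) p; have e2 := divn_eq (u' + a * (m - v')) p.
rewrite -e in e2.
set r := (_ %% p)%N in e1 e2; set q1 := (_ %/ p)%N in e1; set q2 := (_ %/ p)%N in e2.
have hX : (u%:Z - u'%:Z) - a%:Z * (v%:Z - v'%:Z) = (q1%:Z - q2%:Z) * p%:Z.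
  have s1 : (a * (m - v))%:Z = a%:Z * (m%:Z - v%:Z) by rewrite PoszM -subzn // -ltnS.
  have s2 : (a * (m - v'))%:Z = a%:Z * (m%:Z - v'%:Z) by rewrite PoszM -subzn // -ltnS.
  move/(congr1 Posz): e2; move/(congr1 Posz): e1; rewrite !PoszD s1 s2 !PoszM => e1 e2.
  have -> : u%:Z = (q1%:Z * p%:Z + r%:Z) - a%:Z * (m%:Z - v%:Z) by rewrite -e1 addrK.
  have -> : u'%:Z = (q2%:Z * p%:Z + r%:Z) - a%:Z * (m%:Z - v'%:Z) by rewrite -e2 addrK.
  by ring.
have hc' : a%:Z ^+ 2 + 7 = c%:Z * p%:Z.
  by move/(congr1 Posz): hc; rewrite PoszD PoszM -mulnn PoszM.
apply/dvdnP.
set X := u%:Z - u'%:Z in hX *; set Y := v%:Z - v'%:Z in hX *.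
have : (p%:Z %| X ^+ 2 + 7 * Y ^+ 2)%Z.
  have -> : X ^+ 2 + 7 * Y ^+ 2 = p%:Z * ((q1%:Z - q2%:Z) * (X + a%:Z * Y) + c%:Z * Y ^+ 2).
    have -> : X ^+ 2 + 7 * Y ^+ 2 = (X - a%:Z * Y) * (X + a%:Z * Y) + (a%:Z ^+ 2 + 7) * Y ^+ 2 by ring.
    by rewrite hX hc'; ring.
  exact: dvdz_mulr.
have -> : X ^+ 2 + 7 * Y ^+ 2 = (`|X| ^ 2 + 7 * `|Y| ^ 2)%N :> int.
  by rewrite PoszD PoszM -!mulnn !PoszM !abszE -!expr2 !real_normK ?num_real.
by move/dvdnP.
Qed.

(** Divisibility depends only on residues, so anisotropy modulo 3 and modulo 5 becomes a finite
    check. *)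
Lemma x2_7y2_anisotropic_mod (m r s : nat) : (0 < m)%N ->
  [forall i : 'I_m, forall j : 'I_m,
     ((i ^ 2 + 7 * j ^ 2) %% m == 0)%N ==> ((i == 0 :> nat) && (j == 0 :> nat))] ->
  (m %| r ^ 2 + 7 * s ^ 2)%N -> (m %| r)%N /\ (m %| s)%N.
Proof.
move=> m0 /forallP h; rewrite /dvdn.
have /forallP/(_ (Ordinal (ltn_pmod s m0)))/implyP/= := h (Ordinal (ltn_pmod r m0)).
have -> : ((r ^ 2 + 7 * s ^ 2) %% m = ((r %% m) ^ 2 + 7 * (s %% m) ^ 2) %% m)%N.
  by rewrite -modnDm -[in RHS]modnDm -modnMmr -[in RHS]modnMmr !modnXm.
by move=> H /H /andP[].
Qed.

Lemma odd_sqr (r : nat) : odd r -> exists c, (r ^ 2 = 8 * c + 1)%N.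
Proof.
move=> ro; have := odd_double_half r; rewrite ro -muln2; set h := r./2 => <-.
have /dvdnP[c hc] : (2 %| h * h.+1)%N by rewrite dvdn2 oddM /= andbN.
by exists c; nia.
Qed.

(* In r^2 + 7s^2 = kp with 0 < k < 8, congruences mod 8, 3 and 5 leave k = 1,
   k = 7 (divide r by 7) and k = 4 (halve r and s). *)
Lemma prime_x2_7y2 (p : nat) : prime p -> odd p -> (p %% 7)%N \in [:: 1; 2; 4]%N ->
  exists x z : nat, p = (7 * x ^ 2 + z ^ 2)%N.
Proof.
move=> p_pr p_odd p7.
have [a pa] := neg7_square_mod p_pr p7.
have [r [s [/dvdnP[k hk] rs0 hr hs]]] := small_norm_multiple p_pr pa.
have p0 := prime_gt0 p_pr.
(* Both [r ^ 2] and [s ^ 2] are below [p]. *)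
have k8 : (k < 8)%N by rewrite -(ltn_pmul2r p0) -hk; lia.
have k0 : (0 < k)%N.
  rewrite lt0n; apply/eqP => k0; move: hk; rewrite k0 mul0n => /eqP.
  by rewrite addn_eq0 muln_eq0 !expn_eq0 /= !andbT; lia.
have p2 := odd_double_half p; rewrite p_odd -muln2 in p2.
(* If [q] divides [r] and [s], then [q ^ 2] divides [q * p], so [q = p], against the residue of [p]
   modulo 7. *)
have not_prime q : prime q -> (q %% 7)%N \notin [:: 1; 2; 4]%N ->
    (q %| r)%N /\ (q %| s)%N -> k <> q.
  move=> q_pr q7 [/dvdnP[r' er] /dvdnP[s' es]] kq.
  have : (q %| p)%N.
    have q0 := prime_gt0 q_pr.
    have : (q * q %| k * p)%N.
      by rewrite -hk er es; apply/dvdnP; exists (r' ^ 2 + 7 * s' ^ 2)%N; ring.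
    by rewrite kq dvdn_pmul2l.
  by rewrite dvdn_prime2 // => /eqP qp; move: q7; rewrite qp p7.
have kr : (k %| r ^ 2 + 7 * s ^ 2)%N by rewrite hk dvdn_mulr.
(* For [r] and [s] odd the form is divisible by 8, impossible for [k * p] with [p] odd and [k] among
   2, 4, 6. For both even it is divisible by 4, which leaves [k = 4]. *)
have even_k : ~~ odd k -> k = 4%N /\ exists r' s', (r = 2 * r' /\ s = 2 * s')%N.
  move=> ke; have : odd (r ^ 2 + 7 * s ^ 2) = false by rewrite hk oddM (negPf ke).
  rewrite oddD oddM !oddX /= => /negbT; rewrite negb_add => /eqP rs.
  have [ro|re] := boolP (odd r).
    have so : odd s by rewrite -rs.
    have [c hc] := odd_sqr ro; have [c' hc'] := odd_sqr so.
    move: hk; rewrite hc hc'.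
    have : k \in [:: 2; 4; 6]%N by case: (k) k8 k0 ke {kr} => [|[|[|[|[|[|[|[|]]]]]]]].
    by rewrite !inE => /or3P[] /eqP->; lia.
  have se : ~~ odd s by rewrite -rs.
  have hr2 := even_halfK re; have hs2 := even_halfK se; rewrite -muln2 in hr2; rewrite -muln2 in hs2.
  split; last by exists r./2, s./2; split; rewrite mulnC.
  move: hk; rewrite -hr2 -hs2.
  set M := r./2; set M' := s./2.
  have -> : ((M * 2) ^ 2 + 7 * (M' * 2) ^ 2 = 4 * (M ^ 2 + 7 * M' ^ 2))%N by ring.
  set MM := (M ^ 2 + _)%N.
  have : k \in [:: 2; 4; 6]%N by case: (k) k8 k0 ke {kr} => [|[|[|[|[|[|[|[|]]]]]]]].
  by rewrite !inE => /or3P[] /eqP->; lia.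
have [ko|ke] := boolP (odd k); last first.
  have [k4 [r' [s' [er es]]]] := even_k ke.
  exists s', r'; move: hk; rewrite k4 er es.
  have -> : ((2 * r') ^ 2 + 7 * (2 * s') ^ 2 = 4 * (7 * s' ^ 2 + r' ^ 2))%N by ring.
  by rewrite ![(4 * _)%N]mulnC => /eqP; rewrite eqn_pmul2r // => /eqP.
have : k \in [:: 1; 3; 5; 7]%N by case: (k) k8 k0 ko {kr} => [|[|[|[|[|[|[|[|]]]]]]]].
rewrite !inE => /or4P[] /eqP hk'.
- by exists s, r; move: hk; rewrite hk'; lia.
- case: (not_prime 3%N _ _ _ hk') => //; apply: x2_7y2_anisotropic_mod => //; last by move: kr; rewrite hk'.
  by apply/forallP => -[[|[|[|i]]] hi] //; apply/forallP => -[[|[|[|j]]] hj].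
- case: (not_prime 5%N _ _ _ hk') => //; apply: x2_7y2_anisotropic_mod => //; last by move: kr; rewrite hk'.
  by apply/forallP => -[[|[|[|[|[|i]]]]] hi] //; apply/forallP => -[[|[|[|[|[|j]]]]] hj].
- have : (7 %| r ^ 2)%N by move: kr; rewrite hk' dvdn_addl // dvdn_mulr.
  rewrite Euclid_dvdX // andbT => /dvdnP[r' er].
  exists r', s; move: hk; rewrite hk' er.
  have -> : ((r' * 7) ^ 2 + 7 * s ^ 2 = 7 * (7 * r' ^ 2 + s ^ 2))%N by ring.
  by rewrite ![(7 * _)%N]mulnC => /eqP; rewrite eqn_pmul2r // => /eqP.
Qed.

(** Norms from [Z[sqrt(-7)]] multiply; the absolute value keeps the second coordinate natural. *)
Lemma norm_form_mul (x z x' z' : nat) : exists x'' z'' : nat,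
  ((7 * x ^ 2 + z ^ 2) * (7 * x' ^ 2 + z' ^ 2) = 7 * x'' ^ 2 + z'' ^ 2)%N.
Proof.
exists (z * x' + x * z')%N, (absz (z%:Z * z'%:Z - 7 * x%:Z * x'%:Z)%R).
apply/eqP; rewrite -eqz_nat; apply/eqP.
rewrite -!mulnn !(PoszD, PoszM) !abszE -!expr2 !real_normK ?num_real //; ring.
Qed.

Lemma prod_x2_7y2 (n : nat) : (0 < n)%N ->
  (forall p, prime p -> (p %| n)%N -> odd p /\ (p %% 7)%N \in [:: 1; 2; 4]%N) ->
  exists x z : nat, n = (7 * x ^ 2 + z ^ 2)%N.
Proof.
elim/ltn_ind: n => n IH n0 hn.
have [n1|n1] := leqP n 1; first by exists 0%N, 1%N; apply/eqP; rewrite eqn_leq n1.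
have pp := pdiv_prime n1; have pn := pdiv_dvd n.
have [hodd h7] := hn _ pp pn.
have [x [z e]] := prime_x2_7y2 pp hodd h7.
have [x' [z' e']] : exists x z : nat, (n %/ pdiv n = 7 * x ^ 2 + z ^ 2)%N.
  apply: IH; first by rewrite ltn_Pdiv ?prime_gt1.
    by rewrite divn_gt0 ?prime_gt0 // dvdn_leq.
  by move=> q q_pr qn; apply: hn => //; apply: dvdn_trans qn (dvdn_div pn).
have [x'' [z'' e'']] := norm_form_mul x' z' x z.
by exists x'', z''; rewrite -e'' -e -e' divnK.
Qed.

(** Modulo 4, [n = 7 * x ^ 2 + z ^ 2] forces [x] even and [z] odd, whence [n = 28 * y ^ 2 + z ^ 2].
    A prime common to [y] and [n] would divide [z], and its square would divide [n]. *)
Lemma egr_of_norm_form (n : nat) : (n %% 4 = 1)%N -> squarefree n ->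
  (forall p, prime p -> (p %| n)%N -> odd p /\ (p %% 7)%N \in [:: 1; 2; 4]%N) ->
  has_egr_rational_j (7 * n).
Proof.
move=> n4 sqf hp.
have n0 : (0 < n)%N by lia.
have [x [z nE]] := prod_x2_7y2 n0 hp.
have n_odd : odd n by lia.
have xz : odd x != odd z.
  by move: n_odd; rewrite nE oddD oddM !oddX /= => h; case: (odd x) (odd z) h => [] [].
have [x_odd|x_even] := boolP (odd x).
  have z_even : ~~ odd z by move: xz; rewrite x_odd; case: (odd z).
  have [c hc] := odd_sqr x_odd.
  have := even_halfK z_even; rewrite -muln2; set h := z./2 => hz.
  have z4 : (z ^ 2 = 4 * h ^ 2)%N by rewrite -hz expnMn mulnC.
  by lia.
have z_odd : odd z by move: xz; rewrite (negPf x_even); case: (odd z).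
have := even_halfK x_even; rewrite -muln2; set y := x./2 => hx.
have x4 : (x ^ 2 = 4 * y ^ 2)%N by rewrite -hx expnMn mulnC.
have [c hc] := odd_sqr z_odd.
pose e := (n %/ 4)%N.
have ne : n = (4 * e + 1)%N by rewrite {1}(divn_eq n 4) n4 mulnC.
have hn : (4 * e + 1 = 28 * y ^ 2 + z ^ 2)%N by lia.
(* An odd square is 1 modulo 8, so [e] has the parity of [y]. *)
have ey : odd (y + e) = false.
  have : (e = 7 * y ^ 2 + 2 * c)%N by lia.
  by move=> ->; rewrite !(oddD, oddM, oddX) /= addbF addbb.
have hg : (y + e = 2 * (y + e)./2)%N by rewrite mul2n even_halfK // ey.
rewrite ne; apply: (egr_param hn hg z_odd); rewrite -ne.
  rewrite prime_coprime //; apply/negP => h7; by have [] := hp 7%N isT h7.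
apply: contraT => ncop.
have g1 : (1 < gcdn (14 * y) n)%N by rewrite ltn_neqAle eq_sym ncop gcdn_gt0 n0 orbT.
have p_pr := pdiv_prime g1; have := pdiv_dvd (gcdn (14 * y) n).
set p := pdiv _ in p_pr *; rewrite dvdn_gcd => /andP[p14y pn].
have [p_odd p7] := hp p p_pr pn.
have py : (p %| y)%N.
  move: p14y; rewrite (_ : 14 * y = 2 * 7 * y)%N // !Euclid_dvdM //.
  rewrite (@dvdn_prime2 p 2) // (@dvdn_prime2 p 7) //.
  case/orP => [/orP[]|//] /eqP pE; first by move: p_odd; rewrite pE.
  by move: p7; rewrite pE.
have p28 : (p * p %| 28 * y ^ 2)%N by apply: dvdn_mull; rewrite -mulnn; apply: dvdn_mul.
have pz : (p %| z)%N.
  have : (p %| z ^ 2)%N.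
    by rewrite -(dvdn_addr _ (dvdn_trans (dvdn_mulr p (dvdnn p)) p28)) -hn -ne.
  by rewrite Euclid_dvdX // andbT.
by have := sqf p p_pr; rewrite ne hn dvdn_add // -mulnn; apply: dvdn_mul.
Qed.

(** * Logarithms, Abel summation and the character mod 7 *)

Bind Scope ring_scope with R.
Arguments ln _%_ring_scope.

Definition lg (n : nat) : R := ln n%:R.

Lemma lg1 : lg 1 = 0.
Proof. exact: ln_1. Qed.

Lemma natR_gt0 (n : nat) : (0 < n)%N -> 0 < n%:R :> R.
Proof. by rewrite ltr0n. Qed.

Lemma lgM (a b : nat) : (0 < a)%N -> (0 < b)%N -> lg (a * b) = lg a + lg b.
Proof. by move=> a0 b0; rewrite /lg natrM ln_mult //; apply/RltP/natR_gt0. Qed.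

Lemma le_ln (x y : R) : 0 < x -> x <= y -> ln x <= ln y.
Proof.
move=> x0; rewrite le_eqVlt => /orP[/eqP -> //|xy].
by apply/ltW/RltP/ln_increasing; apply/RltP.
Qed.

Lemma le_lg (a b : nat) : (0 < a)%N -> (a <= b)%N -> lg a <= lg b.
Proof. by move=> a0 ab; apply: le_ln; rewrite ?ler_nat // natR_gt0. Qed.

(** [ln] has the default value 0 outside the positive reals. *)
Lemma lg0 : lg 0 = 0.
Proof.
by rewrite /lg /ln; case: Rlt_dec => // h; exfalso; move/RltP: h; rewrite ltxx.
Qed.

Lemma lg_ge0 (n : nat) : 0 <= lg n.
Proof.
case: n => [|n]; last by rewrite -lg1 le_lg.
by rewrite lg0.
Qed.

Lemma lnM (x y : R) : 0 < x -> 0 < y -> ln (x * y) = ln x + ln y.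
Proof. by move=> x0 y0; apply: ln_mult; apply/RltP. Qed.

Lemma ln_le_sub1 (x : R) : 0 < x -> ln x <= x - 1.
Proof.
move=> /RltP x0; have := exp_ineq1_le (ln x); rewrite exp_ln // => /RleP.
rewrite RplusE (_ : IZR 1 = 1) //; lra.
Qed.

Lemma lgS_le (n : nat) : (0 < n)%N -> lg n.+1 <= lg n + n%:R^-1.
Proof.
move=> n0; have n0' := natR_gt0 n0; have n1' := natR_gt0 (ltn0Sn n).
have := @ln_le_sub1 (n.+1%:R / n%:R) (divr_gt0 n1' n0').
have -> : lg n.+1 = lg n + ln (n.+1%:R / n%:R).
  by rewrite /lg -lnM ?divr_gt0 //; congr ln; rewrite mulrC divfK // gt_eqF.
have -> : n.+1%:R / n%:R - 1 = n%:R^-1 :> R by rewrite -natr1; field; rewrite gt_eqF.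
lra.
Qed.

Lemma lgS_ge (n : nat) : (0 < n)%N -> lg n + n.+1%:R^-1 <= lg n.+1.
Proof.
move=> n0; have n0' := natR_gt0 n0; have n1' := natR_gt0 (ltn0Sn n).
have := @ln_le_sub1 (n%:R / n.+1%:R) (divr_gt0 n0' n1').
have -> : lg n = lg n.+1 + ln (n%:R / n.+1%:R).
  by rewrite /lg -lnM ?divr_gt0 //; congr ln; rewrite mulrC divfK // gt_eqF.
have -> : n%:R / n.+1%:R - 1 = - n.+1%:R^-1 :> R by rewrite -natr1; field; rewrite natr1 gt_eqF.
set x := n.+1%:R^-1; lra.
Qed.

Lemma lg_le_pred (n : nat) : (0 < n)%N -> lg n <= n%:R - 1.
Proof. by move=> n0; apply/ln_le_sub1/natR_gt0. Qed.

Lemma lg_le (n : nat) : lg n <= n%:R.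
Proof.
case: n => [|n]; last by have := lg_le_pred (ltn0Sn n); lra.
by rewrite lg0.
Qed.

Lemma lg3_ge1 : 1 <= lg 3.
Proof.
have e3 : exp 1 <= 3%:R.
  by apply/RleP; rewrite -INRE INR_IZR_INZ; apply: exp_le_3.
have -> : 1 = ln (exp 1) by rewrite ln_exp.
by apply: le_ln => //; apply/RltP/exp_pos.
Qed.

Lemma harmonic_ge (N : nat) : lg N.+1 <= \sum_(1 <= n < N.+1) n%:R^-1.
Proof.
elim: N => [|N IH]; first by rewrite lg1 big_geq.
by rewrite big_nat_recr //=; apply: le_trans (lgS_le (ltn0Sn N)) _; rewrite lerD2r.
Qed.

Lemma sum_lg_ge (N : nat) : N%:R * lg N - N%:R <= \sum_(1 <= n < N.+1) lg n.
Proof.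
elim: N => [|N IH]; first by rewrite mul0r subr0 big_geq.
rewrite big_nat_recr //=; apply: le_trans (lerD IH (lexx _)).
case: (posnP N) => [->|N0]; first by rewrite !mul0r !lg1; lra.
have := lgS_le N0; have N0' := natR_gt0 N0; rewrite -(ler_pM2l N0') mulrDr divff ?gt_eqF //.
by rewrite -natr1; lra.
Qed.

Lemma sum_inv_sqr_le (N : nat) : \sum_(1 <= n < N.+1) (n%:R ^+ 2)^-1 <= 2 :> R.
Proof.
case: N => [|N]; first by rewrite big_geq //.
suff : \sum_(1 <= n < N.+2) (n%:R ^+ 2)^-1 <= 2 - N.+1%:R^-1 :> R.
  by move=> h; apply: le_trans h _; rewrite gerBl invr_ge0.
elim: N => [|N IH]; first by rewrite big_nat1 expr1n !invr1; lra.
rewrite big_nat_recr //=; apply: le_trans (lerD IH (lexx _)) _.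
have n1 : 0 < N.+1%:R :> R by rewrite ltr0n.
rewrite -[N.+2%:R]natr1; set x := N.+1%:R in n1 *.
rewrite -subr_ge0 (_ : _ - _ = (x * (x + 1) ^+ 2)^-1); last by field; lra.
by rewrite invr_ge0 mulr_ge0 ?sqr_ge0 // ltW.
Qed.

(** Telescopes against [2 - (lg N + 2) / N]. It serves to bound the prime powers of exponent at
    least 2. *)
Lemma sum_lg_div_le (N : nat) :
  \sum_(2 <= n < N.+1) lg n / (n%:R * (n%:R - 1)) <= 2.
Proof.
case: N => [|N]; first by rewrite big_geq //; lra.
suff : \sum_(2 <= n < N.+2) lg n / (n%:R * (n%:R - 1)) <= 2 - (lg N.+1 + 2) / N.+1%:R.
  move=> h; apply: le_trans h _; rewrite gerBl divr_ge0 // addr_ge0 ?lg_ge0 //.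
elim: N => [|N IH]; first by rewrite big_geq // lg1 divr1; lra.
rewrite big_nat_recr //=; apply: le_trans (lerD IH (lexx _)) _.
have n1 : 0 < N.+1%:R :> R by rewrite ltr0n.
have := lgS_le (ltn0Sn N); set a := lg N.+1; set b := lg N.+2.
rewrite -[N.+2%:R]natr1; set x := N.+1%:R in n1 * => h.
rewrite -subr_ge0 (_ : _ - _ = ((a + x^-1 - b) * x * (x + 1) + (x - 1)) / (x ^+ 2 * (x + 1))).
  have h1 : 0 <= a + x^-1 - b by rewrite subr_ge0.
  have h2 : 0 <= x - 1 by rewrite subr_ge0 /x ler1n.
  have h3 : 0 <= x + 1 by lra.
  by rewrite divr_ge0 ?mulr_ge0 ?sqr_ge0 // addr_ge0 // !mulr_ge0 // ltW.
field; lra.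
Qed.

Lemma sum_dvd (V : nmodType) (q N : nat) (F : nat -> V) : (0 < q)%N ->
  \sum_(1 <= n < N.+1 | (q %| n)%N) F n = \sum_(1 <= m < (N %/ q).+1) F (q * m)%N.
Proof.
move=> q0; elim: N => [|N IH]; first by rewrite div0n !big_geq.
rewrite big_mkcond big_nat_recr //= -big_mkcond IH.
have := divnS N q0; case: ifP => [qN|_] /= e; last by rewrite addr0 e.
rewrite e add1n [in RHS]big_nat_recr //=; congr (_ + F _).
have -> : (N %/ q).+1 = (N.+1 %/ q)%N by rewrite e.
by rewrite mulnC divnK.
Qed.

(** * Abel summation against a nonnegative nonincreasing weight *)

Section AbelSummation.
Variables (f a : nat -> R) (M : nat) (B : R).
Hypothesis a_ge0 : forall n, (M < n)%N -> 0 <= a n.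
Hypothesis a_noninc : forall n, (M < n)%N -> a n.+1 <= a n.

Lemma abel_le : (forall N, (M <= N)%N -> \sum_(M.+1 <= n < N.+1) f n <= B) ->
  forall N, (M <= N)%N -> \sum_(M.+1 <= n < N.+1) f n * a n <= B * a M.+1.
Proof.
move=> hB N MN.
have B0 : 0 <= B by have := hB M (leqnn M); rewrite big_geq.
(* The margin between [B] and the partial sum is carried along so that the induction closes. *)
suff : \sum_(M.+1 <= n < N.+1) f n * a n
   <= B * a M.+1 - (B - \sum_(M.+1 <= n < N.+1) f n) * a N.+1.
  move=> h; apply: le_trans h _; rewrite gerBl mulr_ge0 ?subr_ge0 ?hB ?a_ge0 //.
elim: N MN => [|N IH] MN.
  by move: MN; rewrite leqn0 => /eqP ->; rewrite !big_geq // subr0 subrr.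
move: MN; rewrite leq_eqVlt => /orP[/eqP <-|]; first by rewrite !big_geq // subr0 subrr.
rewrite ltnS => MN; have sB := hB _ (leqW MN); rewrite big_nat_recr //= in sB.
rewrite !(@big_nat_recr _ _ _ N.+1) //=; apply: le_trans (lerD (IH MN) (lexx _)) _.
set S := \sum_(_ <= _ < _) _ in sB *.
have := ler_wpM2l (_ : 0 <= B - (S + f N.+1)) (a_noninc (n := N.+1) _).
rewrite subr_ge0 => /(_ sB MN); lra.
Qed.

End AbelSummation.

Lemma abel_ge (f a : nat -> R) (M : nat) (B : R) :
  (forall n, (M < n)%N -> 0 <= a n) -> (forall n, (M < n)%N -> a n.+1 <= a n) ->
  (forall N, (M <= N)%N -> - B <= \sum_(M.+1 <= n < N.+1) f n) ->
  forall N, (M <= N)%N -> - (B * a M.+1) <= \sum_(M.+1 <= n < N.+1) f n * a n.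
Proof.
move=> a0 an hB N MN; rewrite lerNl -sumrN.
under eq_bigr do rewrite -mulNr.
by apply: abel_le => // N' MN'; rewrite sumrN lerNl hB.
Qed.

(* The Legendre symbol (n / 7). *)
Definition chi (n : nat) : R := nth 0 [:: 0; 1; 1; -1; 1; -1; -1] (n %% 7).

Ltac case_mod7 n :=
  case: (n %% 7)%N (ltn_pmod n (isT : (0 < 7)%N)) => [|[|[|[|[|[|[|//]]]]]]] _ /=.

Lemma chiM (m n : nat) : chi (m * n) = chi m * chi n.
Proof.
rewrite /chi -modnMm; case_mod7 m; case_mod7 n;
  by rewrite ?(mul0r, mulr0, mul1r, mulr1, mulrN, mulNr, opprK).
Qed.

(** A full period sums to 0. That no partial sum is negative is what later keeps [Lsum] away from
    0. *)
Lemma sum_chi (N : nat) :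
  \sum_(1 <= n < N.+1) chi n = nth 0 [:: 0; 1; 2; 1; 2; 1; 0] (N %% 7).
Proof.
elim: N => [|N IH]; first by rewrite big_geq.
rewrite big_nat_recr //= IH /chi -(addn1 N) -modnDml.
by clear IH; case_mod7 N; ring.
Qed.

Lemma sum_chi_bounds (N : nat) : 0 <= \sum_(1 <= n < N.+1) chi n <= 2.
Proof. by rewrite sum_chi; case_mod7 N; lra. Qed.

Lemma chi_le1 (n : nat) : `|chi n| <= 1.
Proof. by rewrite /chi; case_mod7 n; rewrite ?normr0 ?normrN ?normr1. Qed.

Lemma sum_chi_gt (M N : nat) : (M <= N)%N ->
  \sum_(M.+1 <= n < N.+1) chi n = \sum_(1 <= n < N.+1) chi n - \sum_(1 <= n < M.+1) chi n.
Proof. by move=> MN; rewrite [in X in _ = X - _](@big_cat_nat _ _ _ M.+1 1 N.+1) //= [X in _ = X - _]addrC addrK. Qed.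

Lemma sum_chi_weight (a : nat -> R) (M : nat) :
  (forall n, (M < n)%N -> 0 <= a n) -> (forall n, (M < n)%N -> a n.+1 <= a n) ->
  forall N, (M <= N)%N -> `|\sum_(M.+1 <= n < N.+1) chi n * a n| <= 2 * a M.+1.
Proof.
move=> a0 an N MN; rewrite ler_norml; apply/andP; split.
  apply: abel_ge => // N' MN'; rewrite sum_chi_gt //.
  by have := sum_chi_bounds N'; have := sum_chi_bounds M; lra.
apply: abel_le => // N' MN'; rewrite sum_chi_gt //.
by have := sum_chi_bounds N'; have := sum_chi_bounds M; lra.
Qed.

(* Partial sums of L(1, chi) *)
Definition Lsum (N : nat) : R := \sum_(1 <= n < N.+1) chi n / n%:R.

Lemma invn_ge0 (n : nat) : 0 <= n%:R^-1 :> R. Proof. by rewrite invr_ge0. Qed.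

Lemma invn_noninc (n : nat) : (0 < n)%N -> n.+1%:R^-1 <= n%:R^-1 :> R.
Proof. by move=> n0; rewrite lef_pV2 ?posrE ?ltr0n // ler_nat. Qed.

(** The first term is 1. Sums of [chi] starting at 2 are at least -1, so by Abel summation with
    first weight 1/2 the other terms lose at most 1/2. *)
Lemma Lsum_ge (N : nat) : (0 < N)%N -> 1 / 2 <= Lsum N.
Proof.
move=> N0; rewrite /Lsum big_ltn //.
have := @abel_ge chi (fun n => n%:R^-1) 1 1 _ _ _ N N0; rewrite /chi /= => H.
suff : - (1 * 2%:R^-1) <= \sum_(2 <= n < N.+1) chi n / n%:R by rewrite /chi /=; lra.
apply: H => [n _|n n1|N' N1].
- exact: invn_ge0.
- by apply: invn_noninc; apply: leq_trans n1.
- by rewrite -/(chi _) sum_chi_gt // big_nat1 /chi /=; have := sum_chi_bounds N'; rewrite /chi; lra.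
Qed.

Lemma Lsum_diff (M N : nat) : (M <= N)%N -> `|Lsum N - Lsum M| <= 2 / M.+1%:R.
Proof.
move=> MN; rewrite /Lsum (@big_cat_nat _ _ _ M.+1 1 N.+1) //= addrAC subrr add0r.
apply: sum_chi_weight MN => [n _|n n1]; first exact: invn_ge0.
by apply: invn_noninc; apply: leq_trans n1.
Qed.

Lemma Lsum_le (N : nat) : `|Lsum N| <= 2.
Proof. by have := Lsum_diff (leq0n N); rewrite /Lsum [X in _ - X]big_geq // subr0 divr1. Qed.

(** * Chebyshev and Mertens estimates *)

(** The bound [N] is separate from [n], so that one range of primes serves all [n] up to [N] when
    sums are exchanged. *)
Lemma lg_logn (N n : nat) : (0 < n)%N -> (n <= N)%N ->
  lg n = \sum_(1 <= p < N.+1 | prime p) lg p * (logn p n)%:R.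
Proof.
elim/ltn_ind: n => n IH n0 nN.
have [n1|n1] := leqP n 1.
  have -> : n = 1%N by apply/eqP; rewrite eqn_leq n1.
  by rewrite lg1 big1 // => p _; rewrite logn1 mulr0.
have pp := pdiv_prime n1; set q := pdiv n in pp *.
have [m nE] : exists m, n = (q * m)%N by have /dvdnP[m ->] := pdiv_dvd n; exists m; rewrite mulnC.
have q1 := prime_gt1 pp; have m0 : (0 < m)%N by case: (m) nE n0 => // ->; rewrite muln0.
have mn : (m < n)%N by rewrite nE ltn_Pmull.
rewrite {1}nE lgM ?(ltnW q1) // (IH m mn m0 (leq_trans (ltnW mn) nN)).
have -> : lg q = \sum_(1 <= p < N.+1 | prime p) lg p * (p == q)%:R.
  rewrite big_mkcond (bigD1_seq q) ?iota_uniq //=; last first.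
    by rewrite mem_index_iota ltnS (leq_trans _ nN) ?prime_gt0 // nE leq_pmulr.
  rewrite pp eqxx mulr1 big1 ?addr0 // => p /negPf ->.
  by rewrite mulr0 if_same.
rewrite -big_split /=; apply: eq_bigr => p p_pr.
by rewrite -mulrDr -natrD {1}nE lognM ?(ltnW q1) // (logn_prime _ pp) eq_sym.
Qed.

Lemma sum_leq_nat (v N : nat) : \sum_(1 <= k < N.+1) (k <= v)%:R = (minn v N)%:R :> R.
Proof.
elim: N => [|N IH]; first by rewrite big_geq // minn0.
by rewrite big_nat_recr //= IH -natrD; congr (_%:R); lia.
Qed.

Lemma logn_sum (N p n : nat) : prime p -> (0 < n)%N -> (n <= N)%N ->
  (logn p n)%:R = \sum_(1 <= k < N.+1) (p ^ k %| n)%:R :> R.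
Proof.
move=> p_pr n0 nN; under eq_bigr do rewrite pfactor_dvdn //.
rewrite sum_leq_nat; congr (_%:R); apply/esym/minn_idPl.
by apply: leq_trans (ltnW (ltn_logl p n0)) nN.
Qed.

(** Expands [lg] as a divisor sum of the von Mangoldt function and exchanges the sums. The constant
    1 and [chi n / n] as [f] give the two kinds of Mertens estimates. *)
Lemma sum_lg_decomp (f : nat -> R) (N : nat) :
  \sum_(1 <= n < N.+1) f n * lg n =
  \sum_(1 <= p < N.+1 | prime p) lg p *
    \sum_(1 <= k < N.+1) \sum_(1 <= m < (N %/ p ^ k).+1) f (p ^ k * m)%N.
Proof.
transitivity (\sum_(1 <= n < N.+1) \sum_(1 <= p < N.+1 | prime p)
   \sum_(1 <= k < N.+1) (if (p ^ k %| n)%N then lg p * f n else 0)).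
  apply: eq_big_nat => n /andP[n0 nN].
  rewrite (lg_logn n0 nN) mulr_sumr; apply: eq_bigr => p p_pr.
  rewrite (logn_sum p_pr n0 nN) mulrA mulr_sumr; apply: eq_bigr => k _.
  by case: ifP => _; rewrite ?mulr1 ?mulr0 // mulrC.
rewrite exchange_big /=; apply: eq_bigr => p p_pr.
rewrite exchange_big /= mulr_sumr; apply: eq_bigr => k _.
by rewrite -big_mkcond sum_dvd ?expn_gt0 ?prime_gt0 // mulr_sumr.
Qed.

Lemma geom_tail (p N : nat) : (1 < p)%N ->
  \sum_(2 <= k < N.+1) (p%:R ^+ k)^-1 <= (p%:R * (p%:R - 1))^-1 :> R.
Proof.
move=> p1; have p1' : 1 < p%:R :> R by rewrite ltr1n.
have P k : 0 < p%:R ^+ k * (p%:R - 1) :> R.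
  by rewrite mulr_gt0 ?subr_gt0 // exprn_gt0 //; lra.
case: N => [|N]; first by rewrite big_geq // invr_ge0 ltW // -[X in X * _]expr1.
suff -> : \sum_(2 <= k < N.+2) (p%:R ^+ k)^-1 =
   (p%:R * (p%:R - 1))^-1 - (p%:R ^+ N.+1 * (p%:R - 1))^-1 :> R.
  by rewrite gerBl invr_ge0 ltW.
elim: N => [|N IH]; first by rewrite big_geq // expr1 subrr.
rewrite big_nat_recr //= IH !(exprS _ N.+1).
have : p%:R ^+ N.+1 != 0 :> R by rewrite gt_eqF // exprn_gt0 //; lra.
set x := p%:R in p1' *; set y := x ^+ _ => y0; field; lra.
Qed.

(** Chebyshev's theta function, restricted to [P]. *)
Definition theta (P : pred nat) (N : nat) : R := \sum_(1 <= p < N.+1 | prime p && P p) lg p.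

Lemma bin_le_pow2 (n k : nat) : ('C(n, k) <= 2 ^ n)%N.
Proof.
elim: n k => [|n IH] [|k] //; first by rewrite bin0 expn_gt0.
by rewrite binS expnS mul2n -addnn leq_add.
Qed.

(** The primes in [(n, 2n]] divide the central binomial coefficient, which is at most [2 ^ (2 * n)],
    and [lg 2 <= 1]. *)
Lemma theta_double (n : nat) : theta predT (2 * n) <= theta predT n + 2 * n%:R.
Proof.
have C0 : (0 < 'C(2 * n, n))%N by rewrite bin_gt0; lia.
rewrite /theta (@big_cat_nat _ _ _ n.+1) //=; last by lia.
rewrite lerD2l.
apply: (@le_trans _ _ (lg 'C(2 * n, n))).
  rewrite (@lg_logn ('C(2 * n, n) + 2 * n)) //; last by lia.
  rewrite [X in _ <= X](@big_cat_nat _ _ _ n.+1) //=; last by lia.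
  rewrite [X in _ <= _ + X](@big_cat_nat _ _ _ (2 * n).+1) //=; [|lia|lia].
  have pos (s t : nat) : 0 <= \sum_(s <= p < t | prime p) lg p * (logn p 'C(2 * n, n))%:R.
    by apply: sumr_ge0 => p _; rewrite mulr_ge0 ?lg_ge0.
  apply: (@le_trans _ _ (\sum_(n.+1 <= p < (2 * n).+1 | prime p) lg p * (logn p 'C(2 * n, n))%:R)).
    rewrite big_nat_cond [X in _ <= X]big_nat_cond.
    under eq_bigl do rewrite andbT.
    apply: ler_sum => p /andP[/andP[np pn] p_pr].
    rewrite ler_peMr ?lg_ge0 // ler1n logn_gt0 mem_primes p_pr C0 /=.
    have : (p %| (2 * n)`!)%N by rewrite dvdn_fact // prime_gt0.
    rewrite -(bin_fact (_ : n <= 2 * n)%N); last by lia.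
    have nf : ~~ (p %| n`!)%N.
      apply/negP; rewrite -[(p %| _)%N]negbK => /negP; apply.
      elim: (n) np => [|k IH] kp; first by rewrite fact0 dvdn1 gtn_eqF // prime_gt1.
      by rewrite factS Euclid_dvdM // negb_or IH ?andbT ?(ltnW kp) // gtnNdvd.
    by rewrite (_ : 2 * n - n = n)%N; [rewrite !Euclid_dvdM // (negPf nf) !orbF | lia].
  by have := pos 1%N n.+1; have := pos (2 * n).+1 ('C(2 * n, n) + 2 * n).+1; lra.
apply: le_trans (le_lg C0 (bin_le_pow2 _ _)) _.
have lg2 (k : nat) : lg (2 ^ k) <= k%:R.
  elim: k => [|k IH]; first by rewrite expn0 lg1.
  rewrite expnS lgM ?expn_gt0 // -natr1.
  by have := lg_le_pred (isT : 0 < 2)%N; lra.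
by apply: le_trans (lg2 _) _; rewrite natrM.
Qed.

(** Halving: an odd [N = 2m + 1] costs one further term, at most [2m], and the total [8m] still
    suffices. *)
Lemma theta_le (N : nat) : theta predT N <= 4 * N%:R.
Proof.
elim/ltn_ind: N => N IH.
have [N0|N0] := posnP N; first by rewrite N0 /theta big_geq // mulr0.
have h := odd_double_half N; rewrite -mul2n in h; set m := N./2 in h.
have mN : (m < N)%N by lia.
have := theta_double m; have := IH _ mN; have : 0 <= m%:R :> R by [].
have NE : N%:R = (odd N)%:R + 2 * m%:R :> R by rewrite -{1}h natrD natrM.
case: (odd N) h NE => /= h NE; last first.
  by rewrite add0n in h; rewrite NE mulr0n -{1}h; lra.
have step : theta predT N <= theta predT (2 * m) + 2 * m%:R.
  rewrite -h [(true + _)%N]add1n /theta big_mkcond big_nat_recr //= -big_mkcond lerD2l.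
  case: ifP => _; last by rewrite mulr_ge0.
  by have := lg_le_pred (ltn0Sn (2 * m)); rewrite -natr1 natrM; lra.
by rewrite NE mulr1n; lra.
Qed.

Lemma divn_le (N p : nat) : (N %/ p)%:R <= N%:R / p%:R :> R.
Proof.
case: (posnP p) => [->|p0]; first by rewrite divn0 invr0 mulr0.
by rewrite ler_pdivlMr ?natR_gt0 // -natrM ler_nat leq_divM.
Qed.

Lemma divn_gt (N p : nat) : (0 < p)%N -> N%:R / p%:R < (N %/ p).+1%:R :> R.
Proof. by move=> p0; rewrite ltr_pdivrMr ?natR_gt0 // -natrM ltr_nat ltn_ceil. Qed.

Lemma prime_power_tail (N : nat) :
  \sum_(1 <= p < N.+1 | prime p) lg p * (\sum_(2 <= k < N.+1) (p%:R ^+ k)^-1) <= 2.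
Proof.
case: N => [|N]; first by rewrite big_geq //; lra.
apply: le_trans (sum_lg_div_le N.+1).
rewrite big_mkcond big_ltn //= add0r; apply: ler_sum_nat => p /andP[p2 _].
case: ifP => p_pr; first by rewrite ler_wpM2l ?lg_ge0 // geom_tail.
by rewrite mulr_ge0 ?lg_ge0 // invr_ge0 mulr_ge0 // subr_ge0 ler1n ltnW.
Qed.

(** In [log N!] only first powers of primes are kept, with [N %/ p] at least [N / p - 1]; the error
    [theta predT N] is at most [4 * N]. *)
Lemma mertens_le (N : nat) : (0 < N)%N ->
  \sum_(1 <= p < N.+1 | prime p) lg p / p%:R <= lg N + 4.
Proof.
move=> N0; have N0' := natR_gt0 N0.
have up : \sum_(1 <= n < N.+1) 1 * lg n <= N%:R * lg N.
  rewrite mulr_natl.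
  have -> : lg N *+ N = \sum_(1 <= n < N.+1) lg N by rewrite sumr_const_nat subn1.
  by apply: ler_sum_nat => n /andP[n0 nN]; rewrite mul1r le_lg.
have lo : \sum_(1 <= p < N.+1 | prime p) lg p * (N%:R / p%:R - 1) <= \sum_(1 <= n < N.+1) 1 * lg n.
  rewrite (sum_lg_decomp (fun=> 1)); apply: ler_sum => p p_pr.
  rewrite ler_wpM2l ?lg_ge0 // big_ltn // expn1 sumr_const_nat subn1 /=.
  apply: (@le_trans _ _ (N %/ p)%:R).
    by have := divn_gt N (prime_gt0 p_pr); rewrite -natr1; lra.
  by rewrite lerDl sumr_ge0 // => k _; rewrite sumr_ge0.
have e : \sum_(1 <= p < N.+1 | prime p) lg p * (N%:R / p%:R - 1) =
    N%:R * (\sum_(1 <= p < N.+1 | prime p) lg p / p%:R) - theta predT N.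
  rewrite /theta mulr_sumr (eq_bigl prime) ?[X in _ - X](eq_bigl prime) //; last by move=> p; rewrite andbT.
  by rewrite -sumrB; apply: eq_bigr => p _; rewrite mulrBr mulr1 mulrCA.
rewrite -(ler_pM2l N0'); have := theta_le N; move: e lo up.
set S := \sum_(_ <= _ < _ | _) _ / _; lra.
Qed.

(** The lower bound for [log N!] loses [N], and the higher prime powers account for at most
    [2 * N]. *)
Lemma mertens_ge (N : nat) : (0 < N)%N ->
  lg N - 3 <= \sum_(1 <= p < N.+1 | prime p) lg p / p%:R.
Proof.
move=> N0; have N0' := natR_gt0 N0.
have := sum_lg_ge N.
have -> : \sum_(1 <= n < N.+1) lg n = \sum_(1 <= n < N.+1) 1 * lg n.
  by apply: eq_bigr => n _; rewrite mul1r.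
rewrite (sum_lg_decomp (fun=> 1)) => lo.
have up : \sum_(1 <= p < N.+1 | prime p) lg p *
     (\sum_(1 <= k < N.+1) \sum_(1 <= m < (N %/ p ^ k).+1) 1) <=
   N%:R * (\sum_(1 <= p < N.+1 | prime p) lg p / p%:R) +
   N%:R * (\sum_(1 <= p < N.+1 | prime p) lg p * (\sum_(2 <= k < N.+1) (p%:R ^+ k)^-1)).
  rewrite !mulr_sumr -big_split /=; apply: ler_sum => p p_pr.
  rewrite [X in _ <= X + _]mulrCA [X in _ <= _ + X]mulrCA -mulrDr ler_wpM2l ?lg_ge0 //.
  rewrite mulr_sumr big_ltn //; apply: lerD.
    by rewrite expn1 sumr_const_nat subn1 divn_le.
  by apply: ler_sum => k _; rewrite sumr_const_nat subn1 /= -natrX divn_le.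
have := prime_power_tail N; rewrite -(ler_pM2l N0') => tail.
rewrite -(ler_pM2l N0'); move: lo up tail.
set S := \sum_(_ <= _ < _ | _) _ / _; lra.
Qed.

Lemma lg_div_noninc (n : nat) : (2 < n)%N -> lg n.+1 / n.+1%:R <= lg n / n%:R.
Proof.
move=> n3; have n0 : (0 < n)%N by lia.
have n0' := natR_gt0 n0; have n1' := natR_gt0 (ltn0Sn n).
rewrite ler_pdivrMr // mulrAC ler_pdivlMr // -natr1.
have := lgS_le n0; rewrite -(ler_pM2l n0') mulrDr divff ?gt_eqF //.
have := le_lg (isT : 0 < 3)%N n3; have := lg3_ge1; lra.
Qed.

Lemma sum_chi_lg (N : nat) : `|\sum_(1 <= n < N.+1) chi n / n%:R * lg n| <= 4.
Proof.
have e : \sum_(1 <= n < N.+1) chi n / n%:R * lg n = \sum_(1 <= n < N.+1) chi n * (lg n / n%:R).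
  by apply: eq_bigr => n _; rewrite mulrAC mulrA.
have l2 := lg_le_pred (isT : 0 < 2)%N; have l3 := lg_le_pred (isT : 0 < 3)%N.
have p2 := lg_ge0 2; have p3 := lg_ge0 3.
rewrite {}e; have [N2|N2] := leqP N 1.
  case: N N2 => [|[|]] // _; first by rewrite big_geq // normr0.
  by rewrite big_nat1 lg1 mul0r mulr0 normr0.
rewrite (@big_cat_nat _ _ _ 3) //=.
apply: le_trans (ler_normD _ _) _.
have h : `|\sum_(3 <= n < N.+1) chi n * (lg n / n%:R)| <= 2 * (lg 3 / 3%:R).
  by apply: sum_chi_weight => // n n2; [rewrite divr_ge0 ?lg_ge0 | apply: lg_div_noninc].
have h' : `|\sum_(1 <= n < 3) chi n * (lg n / n%:R)| <= 1.
  rewrite big_ltn // big_nat1 lg1 mul0r mulr0 add0r /chi /= mul1r ger0_norm ?divr_ge0 //; lra.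
lra.
Qed.

(** [sum_lg_decomp] turns a sum bounded by 4 into one over prime powers weighted by
    [Lsum (N %/ p ^ k)]. The powers with [k >= 2] cost 4 more, replacing [Lsum (N %/ p)] by [Lsum N]
    costs 8, and dividing by [Lsum N >= 1 / 2] doubles 16 to 32. *)
Lemma sum_chi_prime (N : nat) : (0 < N)%N ->
  `|\sum_(1 <= p < N.+1 | prime p) chi p * (lg p / p%:R)| <= 32.
Proof.
move=> N0; have N0' := natR_gt0 N0.
set B := \sum_(_ <= _ < _ | _) _.
have dec := sum_lg_decomp (fun n => chi n / n%:R) N.
have D4 := sum_chi_lg N; rewrite dec in D4.
have chiX p k : chi (p ^ k) = chi p ^+ k.
  by elim: k => [|k IH]; [rewrite /chi /= | rewrite expnS chiM IH exprS].
have inner p k : \sum_(1 <= m < (N %/ p ^ k).+1) chi (p ^ k * m) / (p ^ k * m)%:R =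
    chi p ^+ k / p%:R ^+ k * Lsum (N %/ p ^ k).
  rewrite /Lsum mulr_sumr; apply: eq_bigr => m _.
  by rewrite chiM chiX natrM natrX invfM; ring.
have chi_abs p k : `|chi p ^+ k / p%:R ^+ k| <= (p%:R ^+ k)^-1.
  rewrite normrM normrX normfV normrX normr_nat.
  by rewrite ler_piMl ?invr_ge0 ?exprn_ge0 // exprn_ile1 // chi_le1.
have main : `|\sum_(1 <= p < N.+1 | prime p) lg p * (chi p / p%:R * Lsum (N %/ p))| <= 8.
  have -> : \sum_(1 <= p < N.+1 | prime p) lg p * (chi p / p%:R * Lsum (N %/ p)) =
     \sum_(1 <= p < N.+1 | prime p) lg p *
       (\sum_(1 <= k < N.+1) \sum_(1 <= m < (N %/ p ^ k).+1) chi (p ^ k * m) / (p ^ k * m)%:R)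
     - \sum_(1 <= p < N.+1 | prime p) lg p *
       (\sum_(2 <= k < N.+1) chi p ^+ k / p%:R ^+ k * Lsum (N %/ p ^ k)).
    rewrite -sumrB; apply: eq_bigr => p p_pr; rewrite -mulrBr; congr (_ * _).
    under eq_bigr do rewrite inner.
    by rewrite big_ltn // !expr1 expn1 addrK.
  apply: le_trans (ler_normB _ _) _.
  suff : `|\sum_(1 <= p < N.+1 | prime p) lg p *
       (\sum_(2 <= k < N.+1) chi p ^+ k / p%:R ^+ k * Lsum (N %/ p ^ k))| <= 2 * 2 by lra.
  apply: le_trans (ler_norm_sum _ _ _) _.
  apply: (@le_trans _ _ (2 * \sum_(1 <= p < N.+1 | prime p) lg p * (\sum_(2 <= k < N.+1) (p%:R ^+ k)^-1))).
    rewrite mulr_sumr; apply: ler_sum => p p_pr.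
    rewrite normrM (ger0_norm (lg_ge0 p)) mulrCA ler_wpM2l ?lg_ge0 // mulr_sumr.
    apply: le_trans (ler_norm_sum _ _ _) _; apply: ler_sum => k _.
    by rewrite normrM mulrC ler_pM // Lsum_le.
  by rewrite ler_pM2l // prime_power_tail.
have err : `|Lsum N * B - \sum_(1 <= p < N.+1 | prime p) lg p * (chi p / p%:R * Lsum (N %/ p))| <= 8.
  rewrite /B mulr_sumr -sumrB; apply: le_trans (ler_norm_sum _ _ _) _.
  (* Each difference of [Lsum] is at most [2 / (N %/ p).+1 <= 2 * p / N], which cancels the [p] in
     [lg p / p] and leaves Chebyshev's bound. *)
  apply: (@le_trans _ _ ((2 / N%:R) * theta predT N)); last first.
    have := theta_le N; rewrite -(ler_pM2l (_ : 0 < 2 / N%:R :> R)) ?divr_gt0 //.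
    have -> : 2 / N%:R * (4 * N%:R) = 8 :> R by field; rewrite gt_eqF.
    by [].
  rewrite /theta (eq_bigl (fun p => prime p && predT p)); last by move=> p; rewrite andbT.
  rewrite mulr_sumr; apply: ler_sum => p /andP[p_pr _].
  have p0' := natR_gt0 (prime_gt0 p_pr).
  have -> : Lsum N * (chi p * (lg p / p%:R)) - lg p * (chi p / p%:R * Lsum (N %/ p)) =
    (chi p * (Lsum N - Lsum (N %/ p)) / p%:R) * lg p by ring.
  rewrite normrM (ger0_norm (lg_ge0 p)) ler_wpM2r ?lg_ge0 //.
  rewrite normrM normfV normr_nat normrM ler_pdivrMr //.
  apply: (@le_trans _ _ (1 * (2 / (N %/ p).+1%:R))).
    by rewrite ler_pM // ?chi_le1 // Lsum_diff // leq_div.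
  rewrite mul1r -mulrA ler_pM2l // mulrC ler_pdivlMr //.
  rewrite mulrC ler_pdivrMr //.
  by have := divn_gt N (prime_gt0 p_pr); rewrite ltr_pdivrMr // => /ltW; rewrite mulrC.
have LB : `|Lsum N * B| <= 16.
  have := ler_normD (Lsum N * B - \sum_(1 <= p < N.+1 | prime p) lg p * (chi p / p%:R * Lsum (N %/ p))) (\sum_(1 <= p < N.+1 | prime p) lg p * (chi p / p%:R * Lsum (N %/ p))).
  rewrite subrK; lra.
have L2 := Lsum_ge N0.
rewrite normrM ger0_norm in LB; last by lra.
have := ler_wpM2r (normr_ge0 B) L2; lra.
Qed.

(** The prime 2 splits in [Q(sqrt(-7))] too, but the products in S are to be odd. *)
Definition split_prime (p : nat) : bool := odd p && (p %% 7 \in [:: 1; 2; 4])%N.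

Lemma split_prime_sum (N : nat) : (0 < N)%N ->
  `|\sum_(1 <= p < N.+1 | prime p && split_prime p) lg p / p%:R - lg N / 2| <= 20.
Proof.
move=> N0.
have A1 := mertens_le N0; have A2 := mertens_ge N0; have := sum_chi_prime N0.
set A := \sum_(_ <= _ < _ | _) _ / _ in A1 A2; set B := \sum_(_ <= _ < _ | _) _ => hB.
set G := \sum_(_ <= _ < _ | _) _.
(* [1 + chi p] is 2 at split primes and 0 at inert ones; only 2 and 7 deviate, contributing at most
   2 and 1. *)
have [d1 d2] : 0 <= A + B - 2 * G /\ A + B - 2 * G <= 3.
  have -> : A + B - 2 * G = \sum_(1 <= p < N.+1 | prime p)
      ((1 + chi p) - (if split_prime p then 2 else 0)) * (lg p / p%:R).
    rewrite /A /B /G mulr_sumr big_mkcondr -big_split -sumrB /=; apply: eq_bigr => p _.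
    by case: ifP => _; ring.
  have E p : prime p -> (1 + chi p) - (if split_prime p then 2 else 0) =
     (if p == 2%N then 2 else 0) + (if p == 7%N then 1 else 0).
    move=> p_pr; case: eqP => [->|p2]; first by rewrite /chi /=; ring.
    have po : odd p by apply: contraT; rewrite -dvdn2 dvdn_prime2 // => /eqP/esym.
    case: eqP => [->|p7]; first by rewrite /chi /=; ring.
    have : (p %% 7)%N != 0%N by rewrite -/(7 %| p)%N dvdn_prime2 //; apply/eqP/nesym.
    by rewrite /split_prime po /chi; case_mod7 p => // _; ring.
  have -> : \sum_(1 <= p < N.+1 | prime p)
      ((1 + chi p) - (if split_prime p then 2 else 0)) * (lg p / p%:R) =
    \sum_(1 <= p < N.+1 | prime p)
       ((if p == 2%N then 2 else 0) + (if p == 7%N then 1 else 0)) * (lg p / p%:R).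
    by apply: eq_bigr => p p_pr; rewrite E.
  split.
    apply: sumr_ge0 => p _; rewrite mulr_ge0 ?divr_ge0 ?lg_ge0 //.
    by case: ifP => _; case: ifP => _; lra.
  have one (q : nat) (c : R) : 0 <= c -> \sum_(1 <= p < N.+1 | prime p) (if p == q then c else 0) * (lg p / p%:R) <= c.
    move=> c0; apply: (@le_trans _ _ (\sum_(1 <= p < N.+1) (if p == q then c else 0))).
      rewrite big_mkcond; apply: ler_sum => p _; case: ifP => _; last by case: ifP.
      case: ifP => _; last by rewrite mul0r.
      case: (posnP p) => [->|p0]; first by rewrite invr0 mulr0 mulr0.
      by rewrite ler_piMr // ler_pdivrMr ?natR_gt0 // mul1r lg_le.
    by rewrite -big_mkcond big_nat1_eq; case: ifP.
  under eq_bigr do rewrite mulrDl.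
  rewrite big_split /=; have := one 2%N 2 _; have := one 7%N 1 _.
  by move=> /(_ ler01) h1 /(_ (ler0n _ 2)) h2; lra.
have [b1 b2] : - 32 <= B /\ B <= 32 by apply/andP; rewrite -ler_norml.
rewrite ler_norml; apply/andP; split; lra.
Qed.

(** From [n] to [K * n] the sum of [lg p / p] grows by at least [lg K / 2 - 40], which exceeds 1,
    and each new [p] exceeds [n]; so [theta split_prime (K * n) >= n]. *)
Lemma theta_split_ge : exists (K : nat) (c : R), [/\ (0 < K)%N, 0 < c &
  forall N, (K <= N)%N -> c * N%:R <= theta split_prime N].
Proof.
have [K K0 lgK] : exists2 K, (0 < K)%N & 100 <= lg K.
  have l2 : 1 / 2 <= lg 2 by have := lgS_ge (isT : 0 < 1)%N; rewrite lg1; lra.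
  have lgX j : lg (2 ^ j) = j%:R * lg 2.
    elim: j => [|i IH]; first by rewrite expn0 lg1 mul0r.
    by rewrite expnS lgM ?expn_gt0 // IH -natr1; ring.
  by exists (2 ^ 200)%N; [rewrite expn_gt0 | rewrite lgX; lra].
have mult n : (0 < n)%N -> n%:R <= theta split_prime (K * n).
  move=> n0; have n0' := natR_gt0 n0; have Kn0 : (0 < K * n)%N by rewrite muln_gt0 K0.
  have := split_prime_sum n0; have := split_prime_sum Kn0; rewrite lgM // !ler_norml.
  rewrite [X in (_ <= X - _ <= _) -> _](@big_cat_nat _ _ _ n.+1) //=; last by rewrite ltnS leq_pmull.
  move=> /andP[h1 _] /andP[_ h2].
  have h3 : 1 <= \sum_(n.+1 <= p < (K * n).+1 | prime p && split_prime p) lg p / p%:R by lra.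
  have : n%:R * 1 <= n%:R * \sum_(n.+1 <= p < (K * n).+1 | prime p && split_prime p) lg p / p%:R.
    by rewrite ler_pM2l.
  rewrite mulr1 => h4; apply: le_trans h4 _.
  rewrite /theta (@big_cat_nat _ _ _ n.+1 1 (K * n).+1) //=; last by rewrite ltnS leq_pmull.
  apply: (@le_trans _ _ (\sum_(n.+1 <= p < (K * n).+1 | prime p && split_prime p) lg p)).
    rewrite mulr_sumr big_nat_cond [X in _ <= X]big_nat_cond.
    apply: ler_sum => p /andP[/andP[np _] _].
    rewrite mulrCA ler_piMr ?lg_ge0 // ler_pdivrMr ?mul1r ?ler_nat ?natR_gt0 //; lia.
  by rewrite lerDr sumr_ge0 // => p _; apply: lg_ge0.
exists K, (2 * K%:R)^-1; split=> //; first by rewrite invr_gt0 mulr_gt0 ?natR_gt0.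
move=> N KN; set n := (N %/ K)%N.
have n0 : (0 < n)%N by rewrite divn_gt0.
have mono : theta split_prime (K * n) <= theta split_prime N.
  rewrite /theta (@big_cat_nat _ _ _ (K * n).+1 1 N.+1) //=; last by rewrite ltnS mulnC leq_divM.
  by rewrite lerDl sumr_ge0 // => p _; apply: lg_ge0.
apply: le_trans mono; apply: le_trans (mult n n0).
rewrite mulrC ler_pdivrMr ?mulr_gt0 ?natR_gt0 // -!natrM ler_nat.
have := ltn_ceil N K0; rewrite -/n; nia.
Qed.

(** * The reciprocal sum over S *)

Lemma sum_div_widen (V : nmodType) (N d : nat) (F : nat -> V) : (0 < d)%N ->
  \sum_(1 <= m < (N %/ d).+1) F m = \sum_(1 <= m < N.+1 | (d * m <= N)%N) F m.
Proof.
move=> d0; rewrite (big_nat_widen _ _ N.+1) ?ltnS ?leq_div //=.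
by apply: eq_bigl => m; rewrite ltnS leq_divRL // mulnC.
Qed.

Lemma hyperbola (V : nmodType) (N : nat) (F : nat -> nat -> V) :
  \sum_(1 <= d < N.+1) \sum_(1 <= m < (N %/ d).+1) F d m =
  \sum_(1 <= m < N.+1) \sum_(1 <= d < (N %/ m).+1) F d m.
Proof.
transitivity (\sum_(1 <= d < N.+1) \sum_(1 <= m < N.+1) (if (d * m <= N)%N then F d m else 0)).
  by apply: eq_big_nat => d /andP[d0 _]; rewrite sum_div_widen // big_mkcond.
rewrite exchange_big /=.
apply: eq_big_nat => m /andP[m0 _]; rewrite sum_div_widen // [RHS]big_mkcond.
by apply: eq_bigr => d _; rewrite mulnC.
Qed.

Lemma divisor_range (V : nmodType) (N n : nat) (P : pred nat) (F : nat -> V) :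
  (0 < n)%N -> (n <= N)%N ->
  \sum_(1 <= d < N.+1 | (d %| n)%N && P d) F d = \sum_(1 <= d < n.+1 | (d %| n)%N && P d) F d.
Proof.
move=> n0 nN; rewrite [RHS](big_nat_widen _ _ N.+1) ?ltnS //=.
apply: eq_bigl => d; rewrite ltnS.
by case: (boolP (d %| n)%N) => //= dn; rewrite (dvdn_leq n0 dn) andbT.
Qed.

(** With [predT] and [n > 0] this counts the ideals of norm [n] in the integers of [Q(sqrt(-7))];
    other [P] isolate the divisors prime to a given [p]. *)
Definition rchi (P : pred nat) (n : nat) : R := \sum_(1 <= d < n.+1 | (d %| n)%N && P d) chi d.
Definition ndiv (n : nat) : R := \sum_(1 <= d < n.+1 | (d %| n)%N && predT d) 1.

Lemma rchi_coprime_part (p m : nat) : prime p -> (0 < m)%N ->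
  rchi (fun d => ~~ (p %| d)%N) (p * m) = rchi (fun d => ~~ (p %| d)%N) m.
Proof.
move=> p_pr m0; have p0 := prime_gt0 p_pr.
rewrite /rchi -(divisor_range _ _ m0 (leq_pmull m p0)).
apply: eq_bigl => d; case: (boolP (p %| d)%N) => pd; rewrite ?andbF //= !andbT.
by rewrite Gauss_dvdr // coprime_sym prime_coprime.
Qed.

(** A divisor of [p * m] is either [p] times a divisor of [m], or prime to [p] and then a divisor of
    [m]. *)
Lemma rchiM (p m : nat) : prime p -> (0 < m)%N ->
  rchi predT (p * m) = chi p * rchi predT m + rchi (fun d => ~~ (p %| d)%N) m.
Proof.
move=> p_pr m0; have p0 := prime_gt0 p_pr.
rewrite {1}/rchi (bigID (fun d => p %| d)%N) /=; congr (_ + _); last first.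
  rewrite -(rchi_coprime_part p_pr m0) /rchi.
  by apply: eq_bigl => d; rewrite andbT.
rewrite (eq_bigl (fun d => (p %| d)%N && (d %| p * m)%N)); last first.
  by move=> d; rewrite andbT andbC.
rewrite big_mkcondr sum_dvd // mulKn // /rchi mulr_sumr [RHS]big_mkcond.
by apply: eq_bigr => d _; rewrite dvdn_pmul2l // andbT chiM.
Qed.

Definition inert (p : nat) : bool := (p %% 7 \in [:: 3; 5; 6])%N.

Lemma chi_inert (p : nat) : inert p -> chi p = -1.
Proof. by rewrite /inert /chi; case_mod7 p. Qed.

Definition no_inert (n : nat) : bool := all (fun p => ~~ inert p) (primes n).

Lemma no_inert_dvd (d n : nat) : (0 < n)%N -> (d %| n)%N -> no_inert n -> no_inert d.
Proof.
move=> n0 dn /allP h; apply/allP => p; rewrite mem_primes => /and3P[p_pr d0 pd].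
by apply: h; rewrite mem_primes p_pr n0 (dvdn_trans pd dn).
Qed.

(** Removing [p ^ 2] for an inert [p] leaves [rchi predT] unchanged, while an inert prime of exact
    exponent 1 makes it vanish. What survives is a square times a part without inert primes, where
    [chi <= 1] applies. *)
Lemma rchi_le_ndiv (n : nat) : (0 < n)%N ->
  rchi predT n <= 0 \/ exists a c : nat,
    [/\ (0 < a)%N, (0 < c)%N, n = (a * c ^ 2)%N, no_inert a & rchi predT n <= ndiv a].
Proof.
elim/ltn_ind: n => n IH n0.
have [ni|] := boolP (no_inert n).
  right; exists n, 1%N; split=> //; first by rewrite muln1.
  by apply: ler_sum => d _; have := chi_le1 d; rewrite ler_norml => /andP[].
rewrite -has_predC => /hasP[p]; rewrite mem_primes /= negbK => /and3P[p_pr _ /dvdnP[m nE]] pi.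
have cp := chi_inert pi; have p1 := prime_gt1 p_pr.
rewrite mulnC in nE; have m0 : (0 < m)%N by case: (m) nE n0 => // ->; rewrite muln0.
have [/dvdnP[k mE]|pm] := boolP (p %| m)%N; last first.
  left; rewrite nE rchiM // cp /rchi.
  rewrite [X in _ + X](eq_bigl (fun d => (d %| m)%N && predT d)) ?mulN1r ?addNr // => d.
  rewrite /= andbT; case: (boolP (d %| m)%N) => //= dm.
  by apply: contra pm => /dvdn_trans; apply.
rewrite mulnC in mE; have k0 : (0 < k)%N by case: (k) mE m0 => // ->; rewrite muln0.
have rn : rchi predT n = rchi predT k.
  by rewrite nE rchiM // mE rchiM // rchi_coprime_part // cp; ring.
have kn : (k < n)%N by rewrite nE mE mulnA ltn_Pmull //; nia.
case: (IH k kn k0) => [h|[a [c [a0 c0 kE na le]]]]; first by left; rewrite rn.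
right; exists a, (p * c)%N; split=> //; last by rewrite rn.
  by rewrite muln_gt0 c0 ltnW.
by rewrite nE mE kE expnMn; ring.
Qed.

(** A union bound: each [n] with [h n > 0] is charged to some index above it; several indices may
    represent the same [n]. *)
Lemma sum_cover (I : eqType) (s : seq I) (phi : I -> nat) (v : I -> R) (h : nat -> R) (N : nat) :
  (forall i, 0 <= v i) ->
  (forall n, (0 < n)%N -> (n <= N)%N ->
     h n <= 0 \/ exists i, [/\ i \in s, phi i = n & h n <= v i]) ->
  \sum_(1 <= n < N.+1) h n <= \sum_(i <- s) v i.
Proof.
move=> v0 hn.
apply: (@le_trans _ _ (\sum_(1 <= n < N.+1) \sum_(i <- s) (if n == phi i then v i else 0))).
  apply: ler_sum_nat => n /andP[n0 nN].
  have pos t : 0 <= \sum_(i <- t) (if n == phi i then v i else 0).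
    by apply: sumr_ge0 => i _; case: ifP.
  case: (hn n n0 nN) => [h0|[i [si <- hv]]]; first exact: le_trans h0 (pos s).
  rewrite (big_rem i) //= eqxx; apply: le_trans hv _; rewrite lerDl.
  by apply: sumr_ge0 => j _; case: ifP.
rewrite exchange_big /=; apply: ler_sum => i _.
by rewrite -big_mkcond big_nat1_eq; case: ifP.
Qed.

Definition inv_sum (P : pred nat) (N : nat) : R := \sum_(1 <= n < N.+1) (if P n then n%:R^-1 else 0).

(** Grouping by the cofactor [e] of the divisor gives [Lsum (N %/ e) / e], and each [Lsum] is at
    least 1/2. *)
Lemma sum_rchi_ge (N : nat) :
  1 / 2 * lg N.+1 <= \sum_(1 <= n < N.+1) rchi predT n / n%:R.
Proof.
apply: (@le_trans _ _ (\sum_(1 <= e < N.+1) e%:R^-1 * Lsum (N %/ e))).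
  apply: (@le_trans _ _ (\sum_(1 <= e < N.+1) e%:R^-1 * (1 / 2))).
    by have := harmonic_ge N; rewrite -mulr_suml; set S := \sum_(_ <= _ < _) _; lra.
  apply: ler_sum_nat => e /andP[e0 eN]; apply: ler_wpM2l; [by rewrite invr_ge0 | by apply: Lsum_ge; rewrite divn_gt0].
rewrite le_eqVlt; apply/orP; left; apply/eqP.
transitivity (\sum_(1 <= e < N.+1) \sum_(1 <= d < (N %/ e).+1) chi d / (d * e)%:R).
  apply: eq_bigr => e _; rewrite /Lsum mulr_sumr; apply: eq_bigr => d _.
  by rewrite natrM invfM; ring.
rewrite -(hyperbola _ (fun d e => chi d / (d * e)%:R)).
transitivity (\sum_(1 <= d < N.+1) \sum_(1 <= n < N.+1 | (d %| n)%N) chi d / n%:R).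
  by apply: eq_big_nat => d /andP[d0 _]; rewrite sum_dvd.
under eq_bigr do rewrite big_mkcond.
rewrite exchange_big /=; apply: eq_big_nat => n /andP[n0 nN].
rewrite /rchi mulr_suml -(divisor_range (N := N)) // [RHS]big_mkcond.
by apply: eq_bigr => d _; rewrite andbT.
Qed.

(** A divisor and its cofactor both inherit [no_inert]; the constraint that their product is at most
    [N] is then dropped. *)
Lemma sum_ndiv_le (N : nat) :
  \sum_(1 <= a < N.+1) (if no_inert a then ndiv a / a%:R else 0) <= inv_sum no_inert N ^+ 2.
Proof.
have -> : \sum_(1 <= a < N.+1) (if no_inert a then ndiv a / a%:R else 0) =
  \sum_(1 <= d < N.+1) \sum_(1 <= a < N.+1 | (d %| a)%N) (if no_inert a then a%:R^-1 else 0).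
  under [RHS]eq_bigr do rewrite big_mkcond.
  rewrite exchange_big /=; apply: eq_big_nat => a /andP[a0 aN].
  rewrite -big_mkcond /ndiv -(divisor_range (N := N)) //.
  case: ifP => _; last by rewrite big1.
  by rewrite mulr_suml; apply: eq_big => [d|d _]; rewrite ?andbT ?mul1r.
rewrite expr2 /inv_sum mulr_suml; apply: ler_sum_nat => d /andP[d0 dN].
rewrite sum_dvd // mulr_sumr sum_div_widen // big_mkcond /=; apply: ler_sum_nat => m /andP[m0 _].
have pos : 0 <= (if no_inert d then d%:R^-1 else 0) * (if no_inert m then m%:R^-1 else 0) :> R.
  by case: ifP; case: ifP => _ _; rewrite mulr_ge0 ?invr_ge0.
case: ifP => // _; case: ifP => // ni.
have dm0 : (0 < d * m)%N by rewrite muln_gt0 d0.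
by rewrite (no_inert_dvd dm0 (dvdn_mulr _ _)) // (no_inert_dvd dm0 (dvdn_mull _ _)) // natrM invfM.
Qed.

(** Membership in the set S. *)
Definition split_squarefree (n : nat) : bool :=
  (0 < n)%N && all (fun p => split_prime p && ~~ (p * p %| n)%N) (primes n).

(** * Removing squares and the primes 2 and 7 *)

Lemma square_part (a : nat) : (0 < a)%N -> exists s e : nat,
  [/\ (0 < e)%N, a = (s * e ^ 2)%N & forall p, prime p -> ~~ (p * p %| s)%N].
Proof.
elim/ltn_ind: a => a IH a0.
have [/hasP[p]|/hasPn h] := boolP (has (fun p => p * p %| a)%N (primes a)).
  rewrite mem_primes => /and3P[p_pr _ _] /dvdnP[b aE]; have p1 := prime_gt1 p_pr.
  have b0 : (0 < b)%N by case: (b) aE a0 => // ->.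
  have ba : (b < a)%N by rewrite aE ltn_Pmulr // (ltn_trans p1) // ltn_Pmull // ltnW.
  have [s [e [e0 bE hs]]] := IH b ba b0.
  exists s, (p * e)%N; split=> //; first by rewrite muln_gt0 e0 ltnW.
  by rewrite aE bE expnMn; ring.
exists a, 1%N; split; rewrite ?muln1 // => p p_pr; apply/negP => pa.
have := h p; rewrite mem_primes p_pr a0 (dvdn_trans (dvdn_mulr p (dvdnn p)) pa) pa => /(_ isT).
by [].
Qed.

Lemma strip_prime (q s : nat) : prime q -> (forall p, prime p -> ~~ (p * p %| s)%N) ->
  exists t s' : nat, [/\ (0 < t <= q)%N, s = (t * s')%N & ~~ (q %| s')%N].
Proof.
move=> q_pr hs; have [/dvdnP[s' sE]|qs] := boolP (q %| s)%N; last first.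
  by exists 1%N, s; split; rewrite ?mul1n ?(prime_gt0 q_pr).
exists q, s'; split; [by rewrite (prime_gt0 q_pr) /= | by rewrite mulnC |].
by apply: contra (hs q q_pr) => /dvdnP[k sE']; rewrite sE sE' -mulnA dvdn_mull.
Qed.

(** [t] collects the factors 2 and 7 of the squarefree part, hence the bound 14. *)
Lemma no_inert_decomp (a : nat) : (0 < a)%N -> no_inert a -> exists t s e : nat,
  [/\ (0 < t <= 14)%N, split_squarefree s, (0 < e)%N & a = (t * s * e ^ 2)%N].
Proof.
move=> a0 ni; have [s [e [e0 aE hs]]] := square_part a0.
have [t [s1 [/andP[t0 t2] sE s12]]] := strip_prime (isT : prime 2) hs.
have hs1 p : prime p -> ~~ (p * p %| s1)%N.
  by move=> p_pr; apply: contra (hs p p_pr); rewrite sE; apply: dvdn_mull.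
have [u [s2 [/andP[u0 u7] s1E s27]]] := strip_prime (isT : prime 7) hs1.
have s2a : (s2 %| a)%N by rewrite aE sE s1E; apply: dvdn_mulr; do 2!apply: dvdn_mull.
exists (t * u)%N, s2, e; split=> //; first by nia.
  rewrite /split_squarefree (dvdn_gt0 a0 s2a) /=; apply/allP => p.
  rewrite mem_primes => /and3P[p_pr _ ps2]; apply/andP; split; last first.
    by apply: contra (hs1 p p_pr); rewrite s1E; apply: dvdn_mull.
  have := allP ni p; rewrite mem_primes p_pr a0 (dvdn_trans ps2 s2a) => /(_ isT).
  have p7 : (p %% 7 != 0)%N.
    by apply: contra s27 => p7; move: p7; rewrite -/(7 %| p)%N dvdn_prime2 // => /eqP->.
  have p2 : odd p.
    by apply: contraT; rewrite -dvdn2 dvdn_prime2 // => /eqP p2; move: s12; rewrite s1E p2 dvdn_mull.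
  by move: p7; rewrite /split_prime /inert p2; case_mod7 p.
by rewrite aE sE s1E; ring.
Qed.

Lemma inv_sum_ge0 (P : pred nat) (N : nat) : 0 <= inv_sum P N.
Proof. by apply: sumr_ge0 => n _; case: ifP => // _; rewrite invr_ge0. Qed.

(** The constant is 14, bounding the sum of [1 / t], times 2, bounding the sum of [1 / e ^ 2]. *)
Lemma inv_sum_no_inert_le (N : nat) :
  inv_sum no_inert N <= 28 * inv_sum split_squarefree N.
Proof.
pose v (i : nat * (nat * nat)) : R := i.1%:R^-1 *
  ((if split_squarefree i.2.1 then i.2.1%:R^-1 else 0) * (i.2.2%:R ^+ 2)^-1).
pose s := [seq (t, w) | t <- index_iota 1 15, w <- [seq (m, e) | m <- index_iota 1 N.+1, e <- index_iota 1 N.+1]].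
apply: (@le_trans _ _ (\sum_(i <- s) v i)).
  apply: (sum_cover (phi := fun i => (i.1 * i.2.1 * i.2.2 ^ 2)%N)) => [i|a a0 aN].
    rewrite !mulr_ge0 ?invr_ge0 ?sqr_ge0 //.
    by case: ifP => // _; rewrite invr_ge0.
  case: ifP => ni; [right | by left].
  have [t [m [e [t14 sm e0 aE]]]] := no_inert_decomp a0 ni.
  have m0 : (0 < m)%N by case/andP: sm.
  have mN : (m <= N)%N.
    by apply: leq_trans (dvdn_leq a0 _) aN; rewrite aE; apply/dvdn_mulr/dvdn_mull.
  have eN : (e <= N)%N.
    by apply: leq_trans (dvdn_leq a0 _) aN; rewrite aE; apply/dvdn_mull/dvdn_exp.
  exists (t, (m, e)); split=> //=.
    apply/allpairsP; exists (t, (m, e)); split=> //=; first by rewrite mem_index_iota; lia.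
    by apply/allpairsP; exists (m, e); split; rewrite //= mem_index_iota ltnS; apply/andP.
  by rewrite /v /= sm aE (natrM _ (t * m)) (natrM _ t) natrX !invfM -!mulrA lexx.
rewrite big_allpairs /v /=.
under eq_bigr do rewrite -mulr_sumr big_allpairs /=.
rewrite -mulr_suml.
have -> : \sum_(1 <= i < N.+1) \sum_(1 <= e < N.+1)
   (if split_squarefree i then i%:R^-1 else 0) * (e%:R ^+ 2)^-1 =
   inv_sum split_squarefree N * \sum_(1 <= e < N.+1) (e%:R ^+ 2)^-1 :> R.
  by rewrite /inv_sum mulr_suml; apply: eq_bigr => i _; rewrite mulr_sumr.
have h14 : \sum_(1 <= t < 15) t%:R^-1 <= 14 :> R.
  have -> : 14 = \sum_(1 <= t < 15) 1 :> R by rewrite sumr_const_nat.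
  by apply: ler_sum_nat => t /andP[t0 _]; rewrite invf_le1 ?natR_gt0 // ler1n.
have h2 := sum_inv_sqr_le N; have F0 := inv_sum_ge0 split_squarefree N.
have -> : 28 * inv_sum split_squarefree N = 14 * (inv_sum split_squarefree N * 2) by ring.
apply: ler_pM => //; first by apply: sumr_ge0 => t _; rewrite invr_ge0.
  by rewrite mulr_ge0 // sumr_ge0 // => e _; rewrite invr_ge0 sqr_ge0.
by rewrite ler_wpM2l.
Qed.

(** [3136 = 2 * 2 * 28 ^ 2], from the [1 / 2] in [sum_rchi_ge], the sum over the squares [c ^ 2],
    and the passage to S. *)
Lemma lg_le_inv_sum_sqr (N : nat) : lg N.+1 <= 3136 * inv_sum split_squarefree N ^+ 2.
Proof.
have h1 := sum_rchi_ge N.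
have h2 : \sum_(1 <= n < N.+1) rchi predT n / n%:R <= inv_sum no_inert N ^+ 2 * 2.
  pose v (i : nat * nat) : R := (if no_inert i.1 then ndiv i.1 / i.1%:R else 0) * (i.2%:R ^+ 2)^-1.
  apply: (@le_trans _ _ (\sum_(i <- [seq (a, c) | a <- index_iota 1 N.+1, c <- index_iota 1 N.+1]) v i)).
    apply: (sum_cover (phi := fun i => (i.1 * i.2 ^ 2)%N)) => [i|n n0 nN].
      rewrite mulr_ge0 // ?invr_ge0 ?sqr_ge0 //; case: ifP => // _.
      by rewrite divr_ge0 // sumr_ge0.
    case: (rchi_le_ndiv n0) => [h|[a [c [a0 c0 nE na le]]]]; [left | right].
      by rewrite pmulr_lle0 // invr_gt0 natR_gt0.
    have aN : (a <= N)%N.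
      by apply: leq_trans (dvdn_leq n0 _) nN; rewrite nE; apply: dvdn_mulr.
    have cN : (c <= N)%N.
      by apply: leq_trans (dvdn_leq n0 _) nN; rewrite nE; apply/dvdn_mull/dvdn_exp.
    exists (a, c); split=> //=.
      by apply/allpairsP; exists (a, c); split; rewrite //= mem_index_iota ltnS; apply/andP.
    have -> : n%:R^-1 = a%:R^-1 * (c%:R ^+ 2)^-1 :> R by rewrite nE natrM natrX invfM.
    by rewrite /v /= na mulrA !ler_wpM2r ?invr_ge0 ?sqr_ge0.
  rewrite big_allpairs /v /=.
  under eq_bigr do rewrite -mulr_sumr.
  rewrite -mulr_suml; apply: ler_pM.
  - apply: sumr_ge0 => a _; case: ifP => // _; rewrite divr_ge0 // sumr_ge0 //.
  - by apply: sumr_ge0 => c _; rewrite invr_ge0 sqr_ge0.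
  - exact: sum_ndiv_le.
  - exact: sum_inv_sqr_le.
have h3 : inv_sum no_inert N ^+ 2 <= (28 * inv_sum split_squarefree N) ^+ 2.
  by rewrite lerXn2r ?nnegrE ?inv_sum_ge0 ?mulr_ge0 ?inv_sum_ge0 ?inv_sum_no_inert_le.
rewrite exprMn in h3; lra.
Qed.

(** * Counting *)

Lemma split_squarefree_mul (p m : nat) : prime p -> split_prime p -> ~~ (p %| m)%N ->
  split_squarefree m -> split_squarefree (p * m).
Proof.
move=> p_pr ps pm /andP[m0 /allP hm].
have p0 := prime_gt0 p_pr; rewrite /split_squarefree muln_gt0 p0 m0 /=.
apply/allP => q; rewrite mem_primes => /and3P[q_pr _].
rewrite Euclid_dvdM // dvdn_prime2 //; have [-> _|qp /= qm] := eqVneq q p.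
  by rewrite ps dvdn_pmul2l.
have := hm q; rewrite mem_primes q_pr m0 qm => /(_ isT) /andP[-> qqm] /=.
rewrite Gauss_dvdr // coprimeMl; have -> // : coprime q p.
by rewrite prime_coprime // dvdn_prime2.
Qed.

Lemma split_squarefree_dvd (d n : nat) : (d %| n)%N -> split_squarefree n -> split_squarefree d.
Proof.
move=> dn /andP[n0 /allP hn]; rewrite /split_squarefree (dvdn_gt0 n0 dn) /=.
apply/allP => p; rewrite mem_primes => /and3P[p_pr _ pd].
have := hn p; rewrite mem_primes p_pr n0 (dvdn_trans pd dn) => /(_ isT) /andP[-> h] /=.
by apply: contra h => /dvdn_trans; apply.
Qed.

Lemma sum_lg_prime_divisors_le (T n : nat) (P : pred nat) : (0 < n)%N ->
  \sum_(1 <= p < T.+1) (if prime p && P p && (p %| n)%N then lg p else 0) <= lg n.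
Proof.
move=> n0; rewrite (@lg_logn (T + n) n n0) ?leq_addl //.
rewrite [X in _ <= X]big_mkcond [X in _ <= X](@big_cat_nat _ _ _ T.+1) //=; last first.
  by rewrite ltnS leq_addr.
apply: ler_wpDr.
  by apply: sumr_ge0 => p _; case: ifP => // _; rewrite mulr_ge0 ?lg_ge0.
apply: ler_sum => p _; case: ifP => [/andP[/andP[p_pr _] pn]|_].
  by rewrite p_pr ler_peMr ?lg_ge0 // ler1n logn_gt0 mem_primes p_pr n0.
by case: ifP => // _; rewrite mulr_ge0 ?lg_ge0.
Qed.

Definition count_split (N : nat) : R := \sum_(1 <= n < N.+1) (split_squarefree n)%:R.

(** For [n] in S, [lg n] is at least the sum of [lg p] over its split prime divisors; an admissible
    pair of [p] and [m] is counted there at [n = p * m]. *)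
Lemma count_split_lg (N : nat) :
  \sum_(1 <= m < N.+1) \sum_(1 <= p < (N %/ m).+1)
    (if prime p && split_prime p && ~~ (p %| m)%N && split_squarefree m then lg p else 0)
  <= count_split N * lg N.
Proof.
apply: (@le_trans _ _ (\sum_(1 <= n < N.+1) (split_squarefree n)%:R * lg n)); last first.
  rewrite /count_split mulr_suml; apply: ler_sum_nat => n /andP[n0 nN].
  by rewrite ler_wpM2l // le_lg.
apply: (@le_trans _ _ (\sum_(1 <= n < N.+1) \sum_(1 <= p < N.+1)
    (if (p %| n)%N then (if prime p && split_prime p && split_squarefree n then lg p else 0) else 0))); last first.
  apply: ler_sum_nat => n /andP[n0 nN].
  case: (split_squarefree n); last by rewrite mul0r big1 // => p _; rewrite andbF if_same.
  rewrite mul1r; apply: le_trans (sum_lg_prime_divisors_le N split_prime n0).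
  by apply: ler_sum => p _; rewrite andbT; case: (p %| n)%N; rewrite ?andbT ?andbF.
rewrite exchange_big /= -hyperbola; apply: ler_sum_nat => p /andP[p0 pN].
rewrite -[X in _ <= X]big_mkcond sum_dvd //; apply: ler_sum_nat => m _.
case: ifP => [/andP[/andP[/andP[p_pr ps] pm] sm]|_]; last by case: ifP => // _; rewrite lg_ge0.
by rewrite p_pr ps split_squarefree_mul.
Qed.

(** For [m <= M] the split primes up to [N / m] have weight at least [c / 2 * (N / m)], with [c]
    from [theta_split_ge], and those dividing [m] remove at most [lg m <= c / 4 * (N / m)]. *)
Lemma count_split_ge : exists (c : R) (N0 : nat), 0 < c /\
  forall M N : nat, (N0 <= N)%N -> (M ^ 3 <= N)%N ->
    c * N%:R * inv_sum split_squarefree M <= count_split N * lg N.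
Proof.
have [K [c [K0 c0 hK]]] := theta_split_ge.
(* Through [D * m ^ 2 <= N], this [D] ensures both [N %/ m >= K] and the bound on [lg m]. *)
have [D [D0 DK Dc]] : exists D : nat, [/\ (0 < D)%N, (K <= D)%N & 4 <= c * D%:R].
  pose D1 := Num.truncn (4 / c).
  have d4 : 0 <= 4 / c by rewrite divr_ge0 // ltW.
  have /andP[_ h] := truncn_itv d4.
  exists (K + D1.+1)%N; split; [lia | lia |].
  rewrite natrD mulrDr; have : 4 <= c * D1.+1%:R by rewrite mulrC -ler_pdivrMr // ltW.
  have : 0 <= c * K%:R by rewrite mulr_ge0 // ltW.
  by rewrite /D1; lra.
exists (c / 4), (D ^ 3)%N; split; first by rewrite divr_gt0.
move=> M N DN MN; have N0 : (0 < N)%N by apply: leq_trans DN; rewrite expn_gt0 D0.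
have MleN : (M <= N)%N by case: (M) MN => [//|M'] MN; apply: leq_trans MN; rewrite -{1}(expn1 M'.+1) leq_pexp2l.
apply: le_trans (count_split_lg N).
rewrite [X in _ <= X](@big_cat_nat _ _ _ M.+1) //=.
apply: ler_wpDr.
  by apply: sumr_ge0 => m _; apply: sumr_ge0 => p _; case: ifP => // _; rewrite lg_ge0.
rewrite /inv_sum mulr_sumr; apply: ler_sum_nat => m /andP[m0 mM].
case: ifP => sm; last first.
  by rewrite mulr0; apply: sumr_ge0 => p _; case: ifP => // _; rewrite lg_ge0.
have m0' := natR_gt0 m0; have D0' := natR_gt0 D0; have N0' := natR_gt0 N0.
have Dmm : (D * m ^ 2 <= N)%N.
  have m2 : (m ^ 2 <= M ^ 2)%N by rewrite leq_sqr.
  have [DM|MD] := leqP D M.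
    by apply: leq_trans MN; rewrite (expnS M 2) leq_mul.
  apply: leq_trans DN; rewrite (expnS D 2) leq_mul //; apply: leq_trans m2 _.
  by rewrite leq_sqr ltnW.
have DmN : (D * m <= N)%N by apply: leq_trans Dmm; rewrite leq_mul // -{1}(expn1 m) leq_pexp2l.
have KNm : (K <= N %/ m)%N by rewrite leq_divRL // (leq_trans _ DmN) // leq_mul.
have q1 : (0 < N %/ m)%N by apply: leq_trans KNm.
have half : N%:R / m%:R <= 2 * (N %/ m)%:R :> R.
  have := divn_gt N m0; have : 1 <= (N %/ m)%:R :> R by rewrite ler1n.
  by rewrite -natr1; lra.
have lgm : lg m <= c / 4 * (N%:R / m%:R).
  apply: le_trans (lg_le m) _.
  have : D%:R * m%:R ^+ 2 <= N%:R :> R by rewrite -natrX -natrM ler_nat.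
  move=> h; rewrite mulrA ler_pdivlMr // -expr2.
  have := ler_wpM2r (sqr_ge0 m%:R) Dc; have := ler_wpM2l (ltW c0) h; lra.
have th := hK _ KNm.
have rad := sum_lg_prime_divisors_le (N %/ m) split_prime m0.
have thE : theta split_prime (N %/ m) =
  \sum_(1 <= p < (N %/ m).+1) (if prime p && split_prime p && (p %| m)%N then lg p else 0) +
  \sum_(1 <= p < (N %/ m).+1)
    (if prime p && split_prime p && ~~ (p %| m)%N && true then lg p else 0).
  rewrite /theta big_mkcond -big_split /=; apply: eq_bigr => p _.
  by case: (prime p && _) => //=; rewrite ?addr0 //; case: (p %| m)%N; rewrite /= ?addr0 ?add0r.
have := ler_wpM2l (ltW c0) half; move: thE th rad lgm.
set A := \sum_(_ <= _ < _) _; set B := \sum_(_ <= _ < _) _; set T := theta _ _.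
rewrite -[c / 4 * N%:R / m%:R]mulrA.
set q := N%:R / m%:R; set f := (N %/ m)%:R; lra.
Qed.

Lemma count_split_asymp : exists (c : R) (N0 : nat), 0 < c /\
  forall N : nat, (N0 <= N)%N -> c * N%:R <= count_split N * Num.sqrt (lg N).
Proof.
have [c [N0 [c0 h]]] := count_split_ge.
exists (c / 100), (N0 + 3)%N; split; first by rewrite divr_gt0.
move=> N NN; have NN0 : (N0 <= N)%N by lia.
have [M [M3 NM]] : exists M, (M ^ 3 <= N)%N /\ (N < M.+1 ^ 3)%N.
  have ex0 : exists m, (m ^ 3 <= N)%N by exists 0%N.
  have ub m : (m ^ 3 <= N)%N -> (m <= N)%N.
    by case: m => // m; apply: leq_trans; rewrite -{1}(expn1 m.+1) leq_pexp2l.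
  exists (ex_maxn ex0 ub); case: ex_maxnP => m hm mx; split => //.
  by rewrite ltnNge; apply/negP => /mx; rewrite ltnn.
have lgN : 1 <= lg N by apply: le_trans lg3_ge1 _; apply: le_lg => //; lia.
set s := Num.sqrt (lg N); have s0 : 0 < s by rewrite sqrtr_gt0; lra.
have ss : s ^+ 2 = lg N by rewrite sqr_sqrtr //; lra.
set F := inv_sum split_squarefree M; have F0 : 0 <= F by apply: inv_sum_ge0.
(* [lg N <= 3 * lg M.+1 <= 9408 * F ^ 2], and 9408 is below [100 ^ 2]. *)
have sF : s <= 100 * F.
  have : lg N <= 3 * lg M.+1.
    have -> : 3 * lg M.+1 = lg (M.+1 ^ 3) by rewrite !expnS expn0 muln1 !lgM ?muln_gt0 //; ring.
    by apply: le_lg (ltnW NM); lia.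
  have := lg_le_inv_sum_sqr M; rewrite -/F -ss => h1 h2.
  rewrite -(@ler_pXn2r _ 2) ?nnegrE ?mulr_ge0 // ?ltW // exprMn.
  have := sqr_ge0 F; lra.
have := h M N NN0 M3; rewrite -/F -ss => h3.
have h4 : c * N%:R * (s / 100) <= c * N%:R * F.
  by apply: ler_wpM2l; [rewrite mulr_ge0 // ltW | lra].
by rewrite -(ler_pM2r s0); lra.
Qed.

(** * The fields [Q(sqrt(7n))] and the residue class of n modulo 4 *)

Lemma split_prime_divisor (n p : nat) : split_squarefree n -> prime p -> (p %| n)%N ->
  split_prime p /\ ~~ (p * p %| n)%N.
Proof.
move=> /andP[n0 /allP h] p_pr pn.
by apply/andP/h; rewrite mem_primes p_pr n0.
Qed.

Lemma split_squarefree_odd (n : nat) : split_squarefree n -> odd n.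
Proof.
move=> sn; apply: contraT; rewrite -dvdn2 => n2.
by have [] := split_prime_divisor sn (isT : prime 2) n2.
Qed.

Lemma egr_split_squarefree (n : nat) : split_squarefree n -> (n %% 4 = 1)%N ->
  [/\ (1 < 7 * n)%N, squarefree (7 * n), qdisc (7 * n) = (28 * n)%N & has_egr_rational_j (7 * n)].
Proof.
move=> sn n4; have n0 : (0 < n)%N by case/andP: sn.
split.
- by lia.
- move=> p p_pr; have [->|p7] := eqVneq p 7%N.
    rewrite dvdn_pmul2l //; apply/negP => n7.
    by have [] := split_prime_divisor sn (isT : prime 7) n7.
  have c7 : coprime p 7 by rewrite prime_coprime // dvdn_prime2.
  rewrite Gauss_dvdr ?coprimeMl ?c7 //; apply/negP => ppn.
  have pn := dvdn_trans (dvdn_mulr p (dvdnn p)) ppn.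
  by have [_] := split_prime_divisor sn p_pr pn; rewrite ppn.
- have d4 : (7 * n %% 4 == 1)%N = false by lia.
  by rewrite /qdisc d4 mulnA.
- apply: egr_of_norm_form => //.
    move=> p p_pr; apply/negP => ppn.
    have pn := dvdn_trans (dvdn_mulr p (dvdnn p)) ppn.
    by have [_] := split_prime_divisor sn p_pr pn; rewrite ppn.
  by move=> p p_pr pn; have [/andP] := split_prime_divisor sn p_pr pn.
Qed.

(* Multiplying or dividing by 11 = 3 (mod 4), a split prime, exchanges the two
   residue classes mod 4. *)
Definition toggle11 (n : nat) : nat := if (11 %| n)%N then (n %/ 11)%N else (11 * n)%N.

Lemma toggle11_split (n : nat) : split_squarefree n -> split_squarefree (toggle11 n).
Proof.
move=> sn; rewrite /toggle11; case: ifP => [n11|/negbT n11].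
  by apply: split_squarefree_dvd sn; apply: dvdn_div.
exact: split_squarefree_mul.
Qed.

Lemma toggle11K (n : nat) : split_squarefree n -> toggle11 (toggle11 n) = n.
Proof.
move=> sn; rewrite /toggle11; have [n11|n11] := boolP (11 %| n)%N; last by rewrite dvdn_mulr // mulKn.
have [_] := split_prime_divisor sn (isT : prime 11) n11.
by move: n11 => /dvdnP[k ->]; rewrite mulnK // dvdn_pmul2r // => /negPf ->; rewrite mulnC.
Qed.

Lemma toggle11_mod4 (n : nat) : (n %% 4 = 3)%N -> (toggle11 n %% 4 = 1)%N.
Proof.
by rewrite /toggle11; case: ifP => [/dvdnP[k ->]|_]; rewrite ?mulnK //; lia.
Qed.

Definition split_1mod4 (N : nat) : seq nat :=
  [seq n <- iota 1 N | split_squarefree n && (n %% 4 == 1)%N].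

(** Members of S are odd, and [toggle11] injects those that are 3 modulo 4 into the class 1 modulo
    4, at the cost of a factor 11 in the range. *)
Lemma count_split_le (N : nat) : count_split N <= 2 * (size (split_1mod4 (11 * N)))%:R.
Proof.
have -> : count_split N = (size [seq n <- iota 1 N | split_squarefree n])%:R.
  rewrite /count_split size_filter -sum1_count natr_sum /index_iota subSS subn0.
  by rewrite [RHS]big_mkcond; apply: eq_bigr => n _; case: ifP.
rewrite -natrM ler_nat size_filter.
rewrite (@eq_count _ _ (predU (fun n => split_squarefree n && (n %% 4 == 1)%N) (fun n => split_squarefree n && (n %% 4 == 3)%N))); last first.
  move=> n /=; rewrite -andb_orr; case: (boolP (split_squarefree n)) => //= sn.
  by have := split_squarefree_odd sn; lia.
apply: leq_trans (leq_addr (count (predI (fun n => split_squarefree n && (n %% 4 == 1)%N)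
   (fun n => split_squarefree n && (n %% 4 == 3)%N)) (iota 1 N)) _) _.
rewrite count_predUI mul2n -addnn; apply: leq_add.
  rewrite -size_filter; apply: uniq_leq_size; first by rewrite filter_uniq ?iota_uniq.
  move=> n; rewrite !mem_filter !mem_iota => /andP[-> /=]; lia.
rewrite -size_filter -(size_map toggle11); apply: uniq_leq_size.
  rewrite map_inj_in_uniq ?filter_uniq ?iota_uniq // => i j.
  rewrite !mem_filter => /andP[/andP[si _] _] /andP[/andP[sj _] _] e.
  by rewrite -(toggle11K si) e toggle11K.
move=> _ /mapP[n + ->]; rewrite !mem_filter !mem_iota => /andP[/andP[sn /eqP n4] nN].
have st := toggle11_split sn; rewrite st toggle11_mod4 //=.
have -> /= : (0 < toggle11 n)%N by case/andP: st.
rewrite /toggle11; case: ifP => _; last lia.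
by apply: (@leq_ltn_trans n); [exact: leq_div | lia].
Qed.

(* R(X) >> X / sqrt(log X): there are c > 0 and X0 such that for every real
   X >= X0 one can exhibit at least c X / sqrt(log X) distinct real quadratic
   fields Q(sqrt d) (d > 1 squarefree, so distinct d give distinct fields)
   of discriminant <= X having an elliptic curve with everywhere good
   reduction and rational j-invariant. *)
Theorem theorem1p1 :
  exists c : R, Rlt 0 c /\
  exists X0 : R, forall X : R, Rle X0 X ->
    exists s : seq nat, uniq s /\
      (forall d : nat, d \in s ->
         [/\ (1 < d)%N, squarefree d, Rle (INR (qdisc d)) X
           & has_egr_rational_j d]) /\
      Rle (Rdiv (Rmult c X) (sqrt (ln X))) (INR (size s)).
Proof.
have [c [N0 [c0 hc]]] := count_split_asymp.
(* [1232 = 2 * 616]: the 2 is from [count_split_le], and [X < 308 * (N + 1) <= 616 * N]. *)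
exists (c / 1232); split; first by apply/RltP; rewrite divr_gt0.
exists (308 * (N0 + 3)%:R) => X /RleP XX.
have X0 : 0 <= X by apply: le_trans XX; rewrite mulr_ge0.
(* The discriminants are [28 * n] with [n <= 11 * N], so at most [308 * N <= X]. *)
pose N := Num.truncn (X / 308).
have /andP[NX XN] : N%:R <= X / 308 < N.+1%:R by apply: truncn_itv; rewrite divr_ge0.
have NN : (N0 + 2 < N)%N.
  rewrite -ltnS -(ltr_nat R); apply: le_lt_trans XN.
  by rewrite ler_pdivlMr // mulrC -addnS.
have N_pos : (0 < N)%N by lia.
exists [seq (7 * n)%N | n <- split_1mod4 (11 * N)]; split; last split.
- rewrite map_inj_uniq; first by rewrite filter_uniq ?iota_uniq.
  by move=> i j /eqP; rewrite eqn_pmul2l // => /eqP.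
- move=> _ /mapP[n + ->]; rewrite mem_filter mem_iota => /andP[/andP[sn /eqP n4] nN].
  have [h1 h2 h3 h4] := egr_split_squarefree sn n4.
  split=> //; apply/RleP; rewrite h3 INRE.
  have : (28 * n)%:R <= 308 * N%:R :> R by rewrite -natrM ler_nat; lia.
  by move: NX; rewrite ler_pdivlMr // mulrC; lra.
- apply/RleP; rewrite size_map INRE RdivE RmultE RsqrtE.
  have h := hc N (leq_trans (leq_addr 2 N0) (ltnW NN)).
  have lgN : 0 < lg N.
    by apply: lt_le_trans ltr01 (le_trans lg3_ge1 (le_lg _ _)) => //; lia.
  have lgX : lg N <= ln X.
    apply: le_ln; first by rewrite ltr0n.
    apply: le_trans NX _; rewrite ler_pdivrMr //; lra.
  have lnX : 0 < ln X by apply: lt_le_trans lgN lgX.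
  rewrite ler_pdivrMr ?sqrtr_gt0 //.
  have sN : Num.sqrt (lg N) <= Num.sqrt (ln X) by rewrite ler_sqrt // ltW.
  have cl := count_split_le N.
  have c_ge0 : 0 <= count_split N by apply: sumr_ge0.
  have s0 : 0 <= Num.sqrt (ln X) by apply: sqrtr_ge0.
  have h1 := ler_wpM2l c_ge0 sN.
  have h2 := ler_wpM2r s0 cl.
  have XN2 : X <= 616 * N%:R.
    move: XN; rewrite ltr_pdivrMr // -natr1 => XN.
    have N1 : 1 <= N%:R :> R by rewrite ler1n.
    by lra.
  have h3 := ler_wpM2l (ltW c0) XN2; lra.
Qed.
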